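(* Let $\xi$ be a Laurent Puiseux series in $x=(x_1,\dots,x_n)$ whose support is included in a translation of a strongly convex cone containing $\mathbb{R}_{\geq 0}^n$ and with coefficients in a field $\mathbb{K}$ of characteristic zero. Assume that $\xi$ is algebraic over $\mathbb{K}(\!(x)\!)$. Then, for every $u\in\mathbb{R}_{>0}^n$ in the boundary of $\tau(\xi)$ there exists a Laurent polynomial $p(x)$ such that, if $F_u$ denotes the face defined by $u$ of the convex hull of $\operatorname{Supp}(\xi+p(x))$, then $$\#\left(F_u\cap\operatorname{Supp}(\xi)\right)=+\infty.$$
   Context: $\mathbb{K}[[x]]$ is the ring of formal power series in $n$ indeterminates and $\mathbb{K}(\!(x)\!)$ its fraction field. A series is a formal sum $\xi=\sum_{\alpha\in\mathbb{Q}^n}\xi_\alpha x^\alpha$ with $\xi_\alpha\in\mathbb{K}$; its support is $\operatorname{Supp}(\xi)=\{\alpha\in\mathbb{Q}^n\mid\xi_\alpha\neq 0\}$. It is a Laurent series if $\operatorname{Supp}(\xi)\subset\mathbb{Z}^n$, and a Laurent Puiseux series if $\operatorname{Supp}(\xi)\subset\frac1k\mathbb{Z}^n$ for some integer $k\geq 1$; a Laurent polynomial is a Laurent series with finite support. A cone is a subset of $\mathbb{R}^n$ stable under multiplication by nonnegative reals; cones are polyhedral (generated by finitely many vectors with nonnegative real coefficients) unless stated otherwise; a cone is strongly convex if it contains no nontrivial linear subspace. When $\operatorname{Supp}(\xi)$ lies in a translation of a strongly convex cone containing $\mathbb{R}_{\geq 0}^n$, $P(x,\xi)$ is well defined for every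 $P\in\mathbb{K}[[x]][T]$, and $\xi$ is algebraic over $\mathbb{K}(\!(x)\!)$ if $P(x,\xi)=0$ for some nonzero such $P$. Define $$\tau(\xi)=\{\omega\in\mathbb{R}_{\geq 0}^n\mid \exists k\in\mathbb{R},\ \operatorname{Supp}(\xi)\cap\{v\in\mathbb{R}^n\mid v\cdot\omega\leq k\}=\emptyset\}.$$ The face of a convex set $A\subset\mathbb{R}^n$ defined by $u$ is the set of points of $A$ at which $v\mapsto v\cdot u$ attains its minimum on $A$.
   Formalization: If Supp(ξ) lies in (1/k)Z^n, p is a Laurent polynomial in x_1^(1/k),…,x_n^(1/k) (finite support in (1/k)Z^n, same k; for k=1 as stated); with integer exponents the claim fails for ξ = x^(-1/2)+Σ x^m y^(-m), u=(1,1). *)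

(* Defs.v *)
From HB Require Import structures.
From mathcomp Require Import all_boot all_order all_algebra.
From mathcomp Require Import all_classical all_reals all_analysis.

Set Implicit Arguments.
Unset Strict Implicit.
Unset Printing Implicit Defensive.

Import Order.TTheory GRing.Theory Num.Theory.
Import numFieldNormedType.Exports.

Local Open Scope classical_set_scope.
Local Open Scope ring_scope.

Section Series.
Variables (n : nat) (K : fieldType).

(* A formal sum over exponents in Q^n is its family of coefficients. *)
Definition formal_series : Type := 'rV[rat]_n -> K.

Implicit Types f g xi : formal_series.

Definition supp f : set 'rV[rat]_n := [set a | f a != 0].

(* The support of f lies in (1/k) Z^n; k = 1 gives the Laurent series. *)
Definition laurent_puiseux (k : nat) f : Prop :=
  forall a, supp f a -> forall i, k%:R * a 0 i \is a Num.int.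

(* Finite support in (1/k) Z^n, i.e. a Laurent polynomial in
   x_1^(1/k), ..., x_n^(1/k); k = 1 gives the Laurent polynomials in x. *)
Definition laurent_puiseux_polynomial (k : nat) f : Prop :=
  laurent_puiseux k f /\ finite_set (supp f).

Definition power_series f : Prop :=
  forall a, supp f a -> forall i, a 0 i \is a Num.nat.

(* The sum over the finitely supported family a |-> f a * g (c - a); it is the
   Cauchy product whenever each of these families has finite support, which is
   the case when the supports lie in (1/k) Z^n and in translations of one same
   strongly convex polyhedral cone. *)
Definition series_mul f g : formal_series :=
  fun c => \sum_(a \in [set: 'rV[rat]_n]) f a * g (c - a).

Definition series_one : formal_series := fun a => (a == 0)%:R.

Definition series_exp f (m : nat) : formal_series :=
  iter m (series_mul f) series_one.

(* The value at T = xi of the polynomial \sum_(i < d) P i T^i. *)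
Definition series_eval (d : nat) (P : 'I_d -> formal_series) xi :
    formal_series :=
  \sum_(i < d) series_mul (P i) (series_exp xi i).

Definition algebraic_series xi : Prop :=
  exists (d : nat) (P : 'I_d -> formal_series),
    [/\ forall i, power_series (P i),
        exists i, P i <> 0 &
        series_eval P xi = 0].

End Series.

Section Geometry.
Variables (R : realType) (n : nat).

Implicit Types (A S : set 'rV[R]_n) (u v w : 'rV[R]_n).

Definition dot v w : R := \sum_i v 0 i * w 0 i.

Definition nonneg_orthant : set 'rV[R]_n := [set v | forall i, 0 <= v 0 i].

Definition polyhedral_cone S : Prop :=
  exists (m : nat) (g : 'I_m -> 'rV[R]_n),
    S = [set v | exists2 c : 'I_m -> R,
                   (forall j, 0 <= c j) & v = \sum_j c j *: g j].

Definition strongly_convex S : Prop :=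
  forall V : {vspace 'rV[R]_n}, [set v | v \in V] `<=` S -> V = 0%VS.

Definition convex_hull A : set 'rV[R]_n := smallest (@convex_set R 'rV[R]_n) A.

Definition face A u : set 'rV[R]_n :=
  [set v | A v /\ forall w, A w -> dot v u <= dot w u].

Definition boundary A : set 'rV[R]_n := closure A `\` interior A.

Definition real_supp (K : fieldType) (f : formal_series n K) : set 'rV[R]_n :=
  map_mx ratr @` supp f.

Definition tau (K : fieldType) (xi : formal_series n K) : set 'rV[R]_n :=
  [set w | nonneg_orthant w /\
    exists k : R, real_supp xi `&` [set v | dot v w <= k] = set0].

End Geometry.

Arguments nonneg_orthant : clear implicits.
Arguments real_supp R {n K} f.
Arguments tau R {n K} xi.

(* Main.v *)
Require Import Defs.
From HB Require Import structures.
From mathcomp Require Import all_boot all_order all_algebra.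
From mathcomp Require Import all_classical all_reals all_analysis.
From mathcomp Require Import ring lra zify.

Set Implicit Arguments.
Unset Strict Implicit.
Unset Printing Implicit Defensive.

Import Order.TTheory GRing.Theory Num.Theory.
Import numFieldNormedType.Exports.

Local Open Scope classical_set_scope.
Local Open Scope ring_scope.

(** Since K has characteristic zero, an algebraic series xi is differentially
    finite: the field generated by xi over the fraction field of K[[x]] has
    finite dimension and is stable under theta_i = x_i d/dx_i, so that for each
    i there is a nontrivial relation
      \sum_q x^q p_{i,q}(theta_i) xi = 0   with q in N^n and p_{i,q} in K[T].
    If q + v (p_{i,q} <> 0, v in Supp xi) can be written in only one way as
    such a sum, then comparing coefficients gives p_{i,q}(v_i) = 0. Exponents v
    for which this occurs for every i, with q of least u-weight, form a finite
    "exceptional" set E. Let w be interior to the dual of the given cone.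
    - The point of Supp xi of least weight for u + t w (t > 0 small) is in E;
      letting t tend to 0, u is bounded below on Supp xi.
    - In a short window of u-weights above a finite part of Supp xi, the
      w-minimal point of each level either is in E or differs from the finite
      part by one of finitely many vectors; hence there are finitely many levels
      in the window, and either every u-sublevel of Supp xi is finite or there
      is a first infinite level, with finitely many points below it. These
      points are removed by p.
    - If every u-sublevel is finite, the same argument bounds all weights near u
      from below on Supp xi, so that u is interior to tau(xi). *)

(** * Derivatives of an algebraic element over a subring of a domain *)

Section AlgebraicDependence.
Variables (H : comNzRingType) (A : set H).
Hypothesis dom : forall x y : H, x * y = 0 -> x = 0 \/ y = 0.
Hypothesis A0 : A 0.
Hypothesis A1 : A 1.
Hypothesis AN : forall x, A x -> A (- x).
Hypothesis AD : forall x y, A x -> A y -> A (x + y).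
Hypothesis AM : forall x y, A x -> A y -> A (x * y).

Definition nontrivial_relation (r : nat) (z : 'I_r -> H) : Prop :=
  exists c : 'I_r -> H,
    [/\ forall j, A (c j), exists j, c j <> 0 & \sum_j c j * z j = 0].

Lemma subring_sum (r : nat) (c : 'I_r -> H) :
  (forall j, A (c j)) -> A (\sum_j c j).
Proof. by move=> Ac; elim/big_ind: _. Qed.

(** Fraction-free Gaussian elimination: a column is cleared by cross-multiplication with a pivot
    instead of division, so the coefficients stay in [A], and a nonzero one stays nonzero because
    [H] is a domain. *)
Lemma overdetermined_kernel (d : nat) (M : 'I_d.+1 -> 'I_d -> H) :
  (forall j i, A (M j i)) ->
  exists c : 'I_d.+1 -> H,
    [/\ forall j, A (c j), exists j, c j <> 0
      & forall i, \sum_j c j * M j i = 0].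
Proof.
elim: d M => [|d IHd] M AM'.
  exists (fun=> 1); split=> //; last by case.
  by exists ord0; apply/eqP; rewrite oner_eq0.
have [M0|/existsNP[j0 /eqP Mj0]] := pselect (forall j, M j ord0 = 0).
  have [c [Ac [j cj] c0]] :=
    IHd (fun j i => M (lift ord0 j) (lift ord0 i)) (fun j i => AM' _ _).
  exists (fun j => if unlift ord0 j is Some j' then c j' else 0); split.
  - by move=> j'; case: unlift.
  - by exists (lift ord0 j); rewrite liftK.
  move=> i; rewrite big_ord_recl unlift_none mul0r add0r.
  under eq_bigr do rewrite liftK.
  case: (unliftP ord0 i) => [i' ->|->]; first exact: c0.
  by rewrite big1// => ? _; rewrite M0 mulr0.
pose M' j i := M j0 ord0 * M (lift j0 j) (lift ord0 i)
               - M (lift j0 j) ord0 * M j0 (lift ord0 i).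
have AM'' j i : A (M' j i) by apply: AD; [|apply: AN]; apply: AM; apply: AM'.
have [c [Ac [j /eqP cj] c0]] := IHd _ AM''.
exists (fun j => if unlift j0 j is Some j' then c j' * M j0 ord0
                 else - \sum_j c j * M (lift j0 j) ord0); split.
- move=> j'; case: unlift => [j''|]; first by apply: AM.
  by apply: AN; apply: subring_sum => j''; apply: AM.
- by exists (lift j0 j); rewrite liftK => /dom[] /eqP; apply/negP.
move=> i; rewrite (bigD1_ord j0)//= unlift_none.
under [X in _ + X]eq_bigr do rewrite liftK.
case: (unliftP ord0 i) => [i' ->|->].
  rewrite -[RHS](c0 i') /M' mulNr mulr_suml -sumrN -big_split/=.
  by apply: eq_bigr => j' _; ring.
rewrite mulNr mulr_suml -sumrN -big_split/= big1// => j' _.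
by ring.
Qed.

Section AlgebraicClosureUnderDerivation.
Variables (d : nat) (P : 'I_d.+1 -> H) (xi : H) (theta : H -> H).
Hypothesis AP : forall i, A (P i).
Hypothesis lead_neq0 : P ord_max <> 0.
Hypothesis P_root : \sum_i P i * xi ^+ i = 0.
Hypothesis dP_neq0 :
  \sum_(i < d) (i.+1%:R * P (lift ord0 i)) * xi ^+ i <> 0.
Hypothesis thetaD : forall x y, theta (x + y) = theta x + theta y.
Hypothesis thetaM : forall x y, theta (x * y) = theta x * y + x * theta y.
Hypothesis A_theta : forall x, A x -> A (theta x).

Definition power_span : set H :=
  [set h | exists2 c : 'I_d -> H, (forall i, A (c i)) &
                                  h = \sum_i c i * xi ^+ i].

(* The elements of the field extension of Frac A generated by xi that lie
   in H. *)
Definition generated : set H :=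
  [set h | exists a, [/\ A a, a <> 0 & power_span (a * h)]].

Lemma power_spanD x y : power_span x -> power_span y -> power_span (x + y).
Proof.
move=> [c Ac ->] [e Ae ->]; exists (fun i => c i + e i).
  by move=> i; apply: AD.
by rewrite -big_split/=; apply: eq_bigr => i _; rewrite mulrDl.
Qed.

Lemma power_spanZ a x : A a -> power_span x -> power_span (a * x).
Proof.
move=> Aa [c Ac ->]; exists (fun i => a * c i); first by move=> i; apply: AM.
by rewrite mulr_sumr; apply: eq_bigr => i _; rewrite mulrA.
Qed.

Lemma power_span0 : power_span 0.
Proof. by exists (fun=> 0) => //; rewrite big1// => i _; rewrite mul0r. Qed.

Lemma neq0M a b : a <> 0 -> b <> 0 -> a * b <> 0 :> H.
Proof. by move=> a0 b0 /dom[]. Qed.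

Lemma generatedD x y : generated x -> generated y -> generated (x + y).
Proof.
move=> [a [Aa a0 ax]] [b [Ab b0 by_]]; exists (a * b).
split; [exact: AM|exact: neq0M|].
have -> : a * b * (x + y) = b * (a * x) + a * (b * y) by ring.
by apply: power_spanD; apply: power_spanZ.
Qed.

Lemma generatedZ a x : A a -> generated x -> generated (a * x).
Proof.
move=> Aa [b [Ab b0 bx]]; exists b; split=> //.
by rewrite mulrCA; apply: power_spanZ.
Qed.

Lemma generatedN x : generated x -> generated (- x).
Proof. by rewrite -mulN1r; apply: generatedZ; apply: AN. Qed.

Lemma generated0 : generated 0.
Proof.
exists 1; split => //; first by apply/eqP; rewrite oner_eq0.
by rewrite mulr0; apply: power_span0.
Qed.

Lemma generated_sum r (z : 'I_r -> H) :
  (forall j, generated (z j)) -> generated (\sum_j z j).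
Proof.
by move=> gz; elim/big_ind: _ => //; [exact: generated0|exact: generatedD].
Qed.

Lemma generated_divA a x : A a -> a <> 0 -> generated (a * x) -> generated x.
Proof.
move=> Aa a0 [b [Ab b0 bx]]; exists (b * a); split; rewrite -?mulrA//.
  exact: AM.
exact: neq0M.
Qed.

(** Only the power [xi ^+ d] leaves the span, and [P_root] rewrites it by lower powers once it is
    multiplied by the leading coefficient of [P]. *)
Lemma generated_xi x : generated x -> generated (xi * x).
Proof.
move=> [a [Aa a0 [c Ac ax]]]; apply: (@generated_divA (P ord_max * a)).
- exact: AM.
- exact: neq0M.
have -> : P ord_max * a * (xi * x) = P ord_max * xi * (a * x) by ring.
rewrite {}ax; exists 1; split => //; first by apply/eqP; rewrite oner_eq0.
rewrite mul1r mulr_sumr.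
have -> : \sum_i P ord_max * xi * (c i * xi ^+ i)
        = \sum_(i < d) P ord_max * (c i * xi ^+ i.+1).
  by apply: eq_bigr => i _; rewrite exprS; ring.
elim/big_ind: _ => //; [exact: power_span0|exact: power_spanD|] => i _.
have [lt_id|] := ltnP i.+1 d.
  exists (fun j => if j == Ordinal lt_id then P ord_max * c i else 0).
    by move=> j; case: ifP => // _; apply: AM.
  rewrite (bigD1 (Ordinal lt_id))//= eqxx big1 ?addr0 ?mulrA// => j /negPf ->.
  by rewrite mul0r.
move=> le_di; have di : i.+1 = d by apply/eqP; rewrite eqn_leq ltn_ord.
have -> : P ord_max * (c i * xi ^+ i.+1) = c i * (P ord_max * xi ^+ d).
  by rewrite di; ring.
apply: power_spanZ => //.
exists (fun j => - P (widen_ord (leqnSn d) j)).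
  by move=> j; apply: AN.
move: P_root; rewrite big_ord_recr/= addrC => /eqP.
rewrite addr_eq0 => /eqP ->; rewrite -sumrN.
by apply: eq_bigr => j _; rewrite mulNr.
Qed.

Lemma generated_xiX m x : generated x -> generated (xi ^+ m * x).
Proof.
move=> gx; elim: m => [|m IH]; rewrite ?expr0 ?mul1r//.
by rewrite exprS -mulrA; apply: generated_xi.
Qed.

Lemma generatedM x y : generated x -> generated y -> generated (x * y).
Proof.
move=> [a [Aa a0 [c Ac ax]]] gy; apply: (generated_divA Aa a0).
rewrite mulrA ax mulr_suml; apply: generated_sum => i.
by rewrite -mulrA; apply: generatedZ => //; apply: generated_xiX.
Qed.

Lemma d_gt0 : (0 < d)%N.
Proof.
case: d P lead_neq0 P_root => // P' P'0.
by rewrite big_ord_recl big_ord0 expr0 mulr1 addr0 (_ : ord0 = ord_max)//;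
  apply: val_inj.
Qed.

Lemma generated1 : generated 1.
Proof.
exists 1; split => //; first by apply/eqP; rewrite oner_eq0.
exists (fun j => if j == Ordinal d_gt0 then 1 else 0).
  by move=> j; case: ifP.
rewrite (bigD1 (Ordinal d_gt0))//= big1 ?addr0 ?expr0// => j /negPf ->.
by rewrite mul0r.
Qed.

Lemma generatedA a : A a -> generated a.
Proof. by move=> Aa; rewrite -[a]mulr1; apply: generatedZ generated1. Qed.

Lemma generatedX x m : generated x -> generated (x ^+ m).
Proof.
move=> gx; elim: m => [|m IH]; first by rewrite expr0; apply: generated1.
by rewrite exprS; apply: generatedM.
Qed.

(** Clearing denominators turns the [d.+1] elements into rows of [d] coefficients on the powers of
    [xi], to which elimination applies. *)
Lemma generated_dependent (z : 'I_d.+1 -> H) :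
  (forall j, generated (z j)) -> nontrivial_relation z.
Proof.
move=> gz.
have /choice[a ha] : forall j, exists a,
    [/\ A a, a <> 0 & power_span (a * z j)].
  by move=> j; have [a ?] := gz j; exists a.
have /choice[c hc] : forall j, exists c : 'I_d -> H,
    (forall i, A (c i)) /\ a j * z j = \sum_i c i * xi ^+ i.
  by move=> j; have [_ _ [c ? ?]] := ha j; exists c.
have [|e [Ae [j ej] e0]] := @overdetermined_kernel d c.
  by move=> j i; have [] := hc j.
exists (fun j => e j * a j); split.
- by move=> i; apply: AM => //; have [] := ha i.
- by exists j; apply: neq0M => //; have [] := ha j.
under eq_bigr => i do rewrite -mulrA (proj2 (hc i)) mulr_sumr.
rewrite exchange_big/= big1// => i _.
by under eq_bigr do rewrite mulrA; rewrite -mulr_suml e0 mul0r.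
Qed.

(* A relation between the powers of y, divided by the largest possible power
   of y, expresses a nonzero element of A as a multiple of y. *)
Lemma generated_div y x :
  generated y -> y <> 0 -> generated (y * x) -> generated x.
Proof.
move=> gy y0 gyx.
suff [a [Aa a0 [g gg ay]]] :
    exists a, [/\ A a, a <> 0 & exists2 g, generated g & a = y * g].
  apply: (generated_divA Aa a0); rewrite ay.
  have -> : y * g * x = g * (y * x) by ring.
  exact: generatedM.
have := @generated_dependent (fun j => y ^+ j) (fun j => generatedX j gy).
move: d.+1 => r [c [Ac cn0 c0]].
elim: r c Ac cn0 c0 => [|r IHr] c Ac [j cj] c0; first by case: j cj.
have [c00|c00] := eqVneq (c ord0) 0; last first.
  exists (c ord0); split => //; first exact/eqP.
  exists (- \sum_(i < r) c (lift ord0 i) * y ^+ i).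
    apply/generatedN/generated_sum => i; apply: generatedM.
      exact: generatedA.
    exact: generatedX.
  move: c0; rewrite big_ord_recl expr0 mulr1 => /eqP; rewrite addr_eq0.
  move=> /eqP ->; rewrite mulrN; congr (- _); rewrite mulr_sumr.
  by apply: eq_bigr => i _; rewrite /= exprS; ring.
apply: (IHr (fun i => c (lift ord0 i))) => //.
  case: (unliftP ord0 j) cj => [i ->|->]; first by exists i.
  by rewrite c00.
have : y * \sum_(i < r) c (lift ord0 i) * y ^+ i = 0.
  rewrite -[RHS]c0 big_ord_recl c00 mul0r add0r mulr_sumr.
  by apply: eq_bigr => i _; rewrite /= exprS; ring.
by case/dom.
Qed.

Lemma theta0 : theta 0 = 0.
Proof. by apply: (addrI (theta 0)); rewrite -thetaD !addr0. Qed.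

Lemma theta1 : theta 1 = 0.
Proof.
apply: (addrI (theta 1)).
by rewrite addr0 -[RHS](congr1 theta (mulr1 1)) thetaM mulr1 mul1r.
Qed.

Lemma theta_sum r (z : 'I_r -> H) : theta (\sum_i z i) = \sum_i theta (z i).
Proof. exact: (big_morph theta thetaD theta0). Qed.

Lemma thetaX m : theta (xi ^+ m) = m%:R * xi ^+ m.-1 * theta xi.
Proof.
elim: m => [|m IH]; first by rewrite expr0 theta1 !mul0r.
rewrite exprS thetaM IH; case: m {IH} => [|m] /=; first by rewrite !expr0; ring.
by rewrite -!natr1 !exprS; ring.
Qed.

Lemma generated_nat m : generated m%:R.
Proof.
apply: generatedA; elim: m => // m IH.
by rewrite -natr1; apply: AD.
Qed.

(** Applying [theta] to [P_root] expresses the product of [theta xi] with the derivative of [P] at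
    [xi] through the [theta (P i)] and powers of [xi]; this derivative is nonzero and can be divided
    out. *)
Lemma generated_theta_xi : generated (theta xi).
Proof.
apply: (generated_div _ dP_neq0).
  apply: generated_sum => i; apply: generatedM.
    by apply: generatedM; [exact: generated_nat|exact: generatedA].
  by rewrite -[X in generated X]mulr1; apply: generated_xiX generated1.
have : theta (\sum_i P i * xi ^+ i) = 0 by rewrite P_root theta0.
rewrite theta_sum; under eq_bigr do rewrite thetaM thetaX.
rewrite big_split/= [X in _ + X]big_ord_recl/= mul0r mul0r mulr0 add0r.
move=> /eqP; rewrite addrC addr_eq0 => /eqP eq1.
have -> : (\sum_(i < d) i.+1%:R * P (lift ord0 i) * xi ^+ i) * theta xi
   = \sum_(i < d) P (lift ord0 i) * ((bump 0 i)%:R * xi ^+ i * theta xi).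
  by rewrite mulr_suml; apply: eq_bigr => i _; rewrite /bump/= add1n; ring.
rewrite eq1; apply/generatedN/generated_sum => i.
by rewrite mulrC; apply/generated_xiX/generatedA/A_theta.
Qed.

Lemma generated_theta x : generated x -> generated (theta x).
Proof.
move=> gx; have [a [Aa a0 [c Ac ax]]] := gx.
apply: (generated_divA Aa a0).
have -> : a * theta x = theta (a * x) - theta a * x by rewrite thetaM; ring.
apply: generatedD; last first.
  by apply/generatedN/generatedM => //; apply/generatedA/A_theta.
rewrite ax theta_sum; apply: generated_sum => i.
rewrite thetaM thetaX; apply: generatedD.
  by rewrite mulrC; apply/generated_xiX/generatedA/A_theta.
apply: generatedM; first exact: generatedA.
rewrite mulrAC mulrC; apply: generated_xiX.
by apply: generatedM; [exact: generated_nat|exact: generated_theta_xi].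
Qed.

Lemma iter_theta_dependent :
  nontrivial_relation (fun l : 'I_d.+1 => iter l theta xi).
Proof.
apply: generated_dependent => -[l _] /=; elim: l => [|l IH] /=.
  by rewrite -[xi]mulr1; apply: generated_xi generated1.
exact: generated_theta.
Qed.

End AlgebraicClosureUnderDerivation.

(** Induction on [d] reaches a polynomial with nonzero leading coefficient and nonzero derivative at
    [xi]: a zero leading coefficient is dropped, and a polynomial whose derivative vanishes at [xi]
    is replaced by this derivative. *)
Lemma algebraic_iter_theta (d : nat) (P : 'I_d -> H) (xi : H)
    (theta : H -> H) :
  (forall m, m.+1%:R <> 0 :> H) ->
  (forall x y, theta (x + y) = theta x + theta y) ->
  (forall x y, theta (x * y) = theta x * y + x * theta y) ->
  (forall x, A x -> A (theta x)) ->
  (forall i, A (P i)) -> (exists i, P i <> 0) ->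
  \sum_i P i * xi ^+ i = 0 ->
  exists r, nontrivial_relation (fun l : 'I_r => iter l theta xi).
Proof.
move=> char0 thetaD thetaM A_theta.
elim/ltn_ind: d P => -[|d] IHd P AP P_neq0 P_root.
  by case: P_neq0 => -[].
have [lead0|/eqP lead_neq0] := eqVneq (P ord_max) 0.
  apply: (IHd d _ (fun i => P (widen_ord (leqnSn d) i))) => //.
    case: P_neq0 => i Pi; case: (unliftP ord_max i) Pi => [j ->|->] // Pj.
    exists j; congr (P _ <> 0): Pj; apply: val_inj => /=.
    by rewrite /bump leqNgt ltn_ord.
  by move: P_root; rewrite big_ord_recr/= lead0 mul0r addr0.
have [dP0|] := pselect
    (\sum_(i < d) (i.+1%:R * P (lift ord0 i)) * xi ^+ i = 0); last first.
  by move=> dP_neq0; exists d.+1; apply: iter_theta_dependent.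
apply: (IHd d _ (fun i => i.+1%:R * P (lift ord0 i))) => //.
  move=> i; apply: AM => //; elim: i.+1 => // m IH.
  by rewrite -natr1; apply: AD.
(* A nonzero constant has no root, so [P] has positive degree, and by characteristic zero its
   derivative has a nonzero leading coefficient. *)
have d_gt0 : (0 < d)%N.
  by apply: (d_gt0 lead_neq0 P_root).
case: d d_gt0 P lead_neq0 {IHd AP P_neq0 P_root dP0} => // d _ P lead_neq0.
exists ord_max; apply: neq0M => //; congr (P _ <> 0): lead_neq0.
exact: val_inj.
Qed.

End AlgebraicDependence.

(** * Weights, finite sublevels and lexicographic minima *)

Lemma finite_argmin (R : realType) (T : choiceType) (f : T -> R) (X : set T) :
  finite_set X -> X !=set0 ->
  exists2 x, X x & forall y, X y -> f x <= f y.
Proof.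
move=> /finite_seqP[s ->]; elim: s => [|a s IHs] [x0 /=] //.
move=> _; have [->|] := eqVneq s [::].
  by exists a => /= [|y]; rewrite inE// => /eqP ->.
case: s IHs => // b s IHs _; have [|x xs xmin] := IHs.
  by exists b; rewrite /= mem_head.
have [le_ax|/ltW lt_xa] := leP (f a) (f x).
  exists a; rewrite /= ?mem_head// => y; rewrite inE => /orP[/eqP ->//|ys].
  exact: le_trans (xmin _ ys).
exists x; first by rewrite /= inE xs orbT.
by move=> y /=; rewrite inE => /orP[/eqP ->//|/xmin].
Qed.

Section Weight.
Variables (R : realType) (n : nat).
Implicit Types (w : 'rV[R]_n) (a b : 'rV[rat]_n) (X Y : set 'rV[rat]_n).

Definition wt w a : R := dot (map_mx ratr a) w.

Lemma wtE w a : wt w a = \sum_i ratr (a 0 i) * w 0 i.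
Proof. by apply: eq_bigr => i _; rewrite mxE. Qed.

Lemma wtD w a b : wt w (a + b) = wt w a + wt w b.
Proof.
rewrite !wtE -big_split/=; apply: eq_bigr => i _.
by rewrite mxE rmorphD mulrDl.
Qed.

Lemma wtB w a b : wt w (a - b) = wt w a - wt w b.
Proof. by apply/(addIr (wt w b)); rewrite -wtD !subrK. Qed.

Lemma wt_addw w w' a : wt (w + w') a = wt w a + wt w' a.
Proof.
rewrite !wtE -big_split/=; apply: eq_bigr => i _.
by rewrite mxE mulrDr.
Qed.

Lemma wt_scalew c w a : wt (c *: w) a = c * wt w a.
Proof.
by rewrite !wtE mulr_sumr; apply: eq_bigr => i _; rewrite mxE mulrCA.
Qed.

Lemma wt_delta i a : wt (delta_mx 0 i) a = ratr (a 0 i).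
Proof.
rewrite wtE (bigD1 i)//= mxE !eqxx mulr1 big1 ?addr0// => j /negPf ji.
by rewrite mxE ji andbF mulr0.
Qed.

(** Stands in for a well-ordering by weight: minima exist on every nonempty subset, and an exponent
    is a sum of elements of two such sets, for the same [w], in finitely many ways only. *)
Definition sublevel_finite w X : Prop :=
  forall c, finite_set (X `&` [set a | wt w a <= c]).

Definition argmin w X : set 'rV[rat]_n :=
  [set a | X a /\ forall b, X b -> wt w a <= wt w b].

Lemma argmin_neq0 w X : sublevel_finite w X -> X !=set0 -> argmin w X !=set0.
Proof.
move=> finX [a Xa].
have [|x [Xx /= xa] xmin] := finite_argmin (wt w) (finX (wt w a)).
  by exists a; split=> /=.
exists x; split=> // b Xb; have [ba|/ltW ab] := leP (wt w b) (wt w a).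
  exact: xmin.
exact: le_trans ab.
Qed.

Lemma argmin_finite w X : sublevel_finite w X -> finite_set (argmin w X).
Proof.
move=> finX; have [->|/set0P[a [Xa amin]]] := eqVneq (argmin w X) set0.
  exact: finite_set0.
apply: sub_finite_set (finX (wt w a)) => b [Xb bmin].
by split=> //=; apply: bmin.
Qed.

Lemma sublevel_finite_sub w X Y :
  X `<=` Y -> sublevel_finite w Y -> sublevel_finite w X.
Proof. by move=> XY finY c; apply: sub_finite_set (finY c) => a [/XY]. Qed.

Lemma sublevel_finite_lb w X : sublevel_finite w X ->
  exists m, forall a, X a -> m <= wt w a.
Proof.
move=> finX; have [->|/set0P Xn0] := eqVneq X set0; first by exists 0.
by have [a [_ amin]] := argmin_neq0 finX Xn0; exists (wt w a).
Qed.

Lemma finite_sublevel w X : finite_set X -> sublevel_finite w X.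
Proof. by move=> finX c; apply: finite_setIl. Qed.

Definition coords : seq 'rV[R]_n := [seq delta_mx 0 i | i <- enum 'I_n].

(** Plays the role of a monomial order in which each weight breaks the ties left by the previous
    ones; with [coords] at the end of the list at most one point is left. *)
Fixpoint lexmin (ws : seq 'rV[R]_n) X : set 'rV[rat]_n :=
  if ws is w :: ws' then lexmin ws' (argmin w X) else X.

Lemma lexmin_sub ws X : lexmin ws X `<=` X.
Proof.
elim: ws X => [|w ws IHws] X //= a /IHws.
by case.
Qed.

Lemma lexmin_argmin w ws X : lexmin (w :: ws) X `<=` argmin w X.
Proof. exact: (@lexmin_sub ws). Qed.

Lemma lexmin_finite_neq0 ws X :
  finite_set X -> X !=set0 -> lexmin ws X !=set0.
Proof.
elim: ws X => [|w ws IHws] X //= finX Xn0; apply: IHws.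
  by apply: sub_finite_set finX => a [].
by apply: argmin_neq0 => //; apply: finite_sublevel.
Qed.

Lemma lexmin_neq0 w ws X :
  sublevel_finite w X -> X !=set0 -> lexmin (w :: ws) X !=set0.
Proof.
move=> finX Xn0; apply: (@lexmin_finite_neq0 ws); first exact: argmin_finite.
exact: argmin_neq0.
Qed.

Lemma lexmin_wt ws X a b w : lexmin ws X a -> lexmin ws X b -> w \in ws ->
  wt w a = wt w b.
Proof.
elim: ws X => [//|w0 ws IHws] X la lb; rewrite inE => /orP[/eqP ->|].
  have [Xa amin] := lexmin_argmin la; have [Xb bmin] := lexmin_argmin lb.
  by apply/eqP; rewrite eq_le amin// bmin.
exact: IHws la lb.
Qed.

Lemma lexmin_coords_inj ws X a b :
  lexmin (ws ++ coords) X a -> lexmin (ws ++ coords) X b -> a = b.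
Proof.
move=> la lb; apply/rowP => i.
suff : ratr (a 0 i) = ratr (b 0 i) :> R by apply: fmorph_inj.
rewrite -!wt_delta.
apply: lexmin_wt la lb _; rewrite mem_cat; apply/orP; right.
by apply: map_f; rewrite mem_enum.
Qed.

(** At each weight a sum of two minima is only reached by two minima, and this persists through the
    successive minimizations. It excludes cancellation at an extremal exponent of a product. *)
Lemma lexmin_add ws X Y a b a' b' :
  lexmin (ws ++ coords) X a -> lexmin (ws ++ coords) Y b ->
  X a' -> Y b' -> a' + b' = a + b -> a' = a /\ b' = b.
Proof.
move=> la lb Xa' Yb' eqab.
suff [la' lb'] : lexmin (ws ++ coords) X a' /\ lexmin (ws ++ coords) Y b'.
  by split; [exact: lexmin_coords_inj la' la|exact: lexmin_coords_inj lb' lb].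
elim: {ws}(ws ++ coords) X Y Xa' Yb' la lb => [//|w ws IHws] X Y Xa' Yb' la lb.
have [Xa amin] := lexmin_argmin la; have [Yb bmin] := lexmin_argmin lb.
have wt_eq : wt w a' + wt w b' = wt w a + wt w b by rewrite -!wtD eqab.
have := amin _ Xa'; have := bmin _ Yb' => hb ha.
have ea : wt w a' = wt w a by lra.
have eb : wt w b' = wt w b by lra.
by apply: IHws => //; split=> // c; rewrite ?ea ?eb; [exact: amin|exact: bmin].
Qed.

End Weight.

(** * The domain of series with sublevel-finite support *)

Section SeriesRing.
Variables (R : realType) (n : nat) (K : fieldType) (w : 'rV[R]_n).
Implicit Types (f g h : formal_series n K) (a b c : 'rV[rat]_n).

Lemma series_mulE f g c (s : seq 'rV[rat]_n) : uniq s ->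
  (forall a, f a != 0 -> g (c - a) != 0 -> a \in s) ->
  series_mul f g c = \sum_(a <- s) f a * g (c - a).
Proof.
move=> us fgs; rewrite /series_mul (fsbigE s)//.
  by apply: eq_bigl => a; rewrite in_setT.
move=> a _ nas; apply/eqP; rewrite mulf_eq0; apply: contraNT nas.
by rewrite negb_or => /andP[]; exact: fgs.
Qed.

Lemma finite_set_seq (X : set 'rV[rat]_n) : finite_set X ->
  exists2 s, uniq s & forall a, X a <-> a \in s.
Proof.
move=> /finite_seqP[s ->]; exists (undup s); first exact: undup_uniq.
by move=> a; rewrite mem_undup.
Qed.

Definition sfin f : Prop := sublevel_finite w (supp f).

Lemma series_mul_neq0 f g c : series_mul f g c != 0 ->
  exists a, f a != 0 /\ g (c - a) != 0.
Proof.
apply: contra_neqP => /forallNP fg0; rewrite /series_mul fsbig1// => a _.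
apply/eqP; rewrite mulf_eq0; apply/negPn/negP; rewrite negb_or => /andP[fa ga].
by apply: (fg0 a).
Qed.

Lemma sfin_range f (c : R) : sfin f ->
  exists2 s, uniq s & forall a, f a != 0 -> wt w a <= c -> a \in s.
Proof.
move=> /(_ c)/finite_set_seq[s us sP]; exists s => // a fa ac.
by apply/sP; split.
Qed.

Lemma sfin_add f g : sfin f -> sfin g -> sfin (f + g).
Proof.
move=> ff fg c; apply: sub_finite_set (_ : finite_set
  ((supp f `&` [set a | wt w a <= c]) `|` (supp g `&` [set a | wt w a <= c]))).
  move=> a [fga ac]; have [fa|fa] := eqVneq (f a) 0; last by left.
  right; split=> //; apply: contraNN fga => /eqP ga.
  by rewrite (_ : (f + g) a = f a + g a)// fa ga addr0.
by rewrite finite_setU; split; [exact: ff|exact: fg].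
Qed.

Lemma sfin_opp f : sfin f -> sfin (- f).
Proof.
apply: sublevel_finite_sub => a; rewrite /supp/= => fa.
by apply: contraNN fa => /eqP fa; rewrite (_ : (- f) a = - f a)// fa oppr0.
Qed.

Lemma sfin_mul f g : sfin f -> sfin g -> sfin (series_mul f g).
Proof.
move=> ff fg c.
have [mf mfP] := sublevel_finite_lb ff; have [mg mgP] := sublevel_finite_lb fg.
apply: sub_finite_set
  (finite_image2 (fun a b => a + b) (ff (c - mg)) (fg (c - mf))).
move=> a [/series_mul_neq0[b [fb gab]] /= ac].
have := mfP _ fb; have := mgP _ gab; rewrite wtB => h1 h2.
exists b; first by split=> //=; lra.
by exists (a - b); [split=> //=; rewrite wtB; lra|rewrite addrC subrK].
Qed.

Lemma series_mulC f g : series_mul f g = series_mul g f.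
Proof.
apply/funext => c.
rewrite /series_mul (@reindex_fsbigT _ _ _ _ _ (fun a => c - a)).
  by apply: eq_fsbigr => a _; rewrite subKr mulrC.
by exists (fun a => c - a) => a; rewrite subKr.
Qed.

(** Both sides are the same finite double sum over exponents [b] of [f] and [a] of [h], the exponent
    of [g] being determined by these. *)
Lemma series_mulA f g h : sfin f -> sfin g -> sfin h ->
  series_mul f (series_mul g h) = series_mul (series_mul f g) h.
Proof.
move=> ff fg fh; apply/funext => c.
have [mf mfP] := sublevel_finite_lb ff; have [mg mgP] := sublevel_finite_lb fg.
have [mh mhP] := sublevel_finite_lb fh.
have [s us sP] := sfin_range (wt w c - mg - mh) ff.
have [t ut tP] := sfin_range (wt w c - mf - mg) fh.
rewrite (series_mulE us); last first.
  move=> b fb /series_mul_neq0[a [ga hcba]]; apply: sP => //.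
  by have := mgP _ ga; have := mhP _ hcba; rewrite !wtB; lra.
have inj_sub : injective (fun a : 'rV[rat]_n => c - a).
  by move=> a b /addrI/oppr_inj.
rewrite (@series_mulE _ _ _ [seq c - a | a <- t]); first last.
- move=> a /series_mul_neq0[b [fb gab]] hca; apply/mapP.
  exists (c - a); rewrite ?subKr//.
  apply: tP => //; have := mfP _ fb; have := mgP _ gab; rewrite !wtB; lra.
- by rewrite map_inj_uniq.
rewrite big_map.
transitivity (\sum_(b <- s) \sum_(a <- t) f b * (g (c - a - b) * h a)).
  rewrite [LHS]big_seq [RHS]big_seq; apply: eq_bigr => b _.
  have [->|fb] := eqVneq (f b) 0.
    by rewrite mul0r big1// => a _; rewrite mul0r.
  rewrite (@series_mulE _ _ _ [seq c - a - b | a <- t]); first last.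
  - move=> a ga hcba; apply/mapP; exists (c - b - a); last first.
      by rewrite -[c - b - a]addrA -opprD subKr [RHS]addrC addKr.
    apply: tP => //.
    by have := mfP _ fb; have := mgP _ ga; rewrite !wtB; lra.
  - by rewrite map_inj_uniq// => a a' /addIr/inj_sub.
  rewrite big_map mulr_sumr; apply: eq_bigr => a _; congr (_ * (_ * h _)).
  by rewrite opprB addrA [c - b + b]subrK subKr.
rewrite exchange_big/= [LHS]big_seq [RHS]big_seq; apply: eq_bigr => a _.
rewrite subKr; have [->|ha] := eqVneq (h a) 0.
  by rewrite mulr0 big1// => b _; rewrite !mulr0.
rewrite (series_mulE us) ?mulr_suml; last first.
  move=> b fb gab; apply: sP => //.
  by have := mgP _ gab; have := mhP _ ha; rewrite !wtB; lra.
by apply: eq_bigr => b _; rewrite mulrA.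
Qed.

Lemma series_mul1 f : series_mul (@series_one n K) f = f.
Proof.
apply/funext => c; rewrite (@series_mulE _ _ _ [:: 0])//.
  by rewrite big_seq1 /series_one eqxx mul1r subr0.
move=> a; rewrite /series_one inE.
by case: (a == 0) => //=; rewrite ?mulr0n ?eqxx.
Qed.

Lemma series_mulDl f g h : sfin f -> sfin g -> sfin h ->
  series_mul (f + g) h = series_mul f h + series_mul g h.
Proof.
move=> ff fg fh; apply/funext => c.
transitivity (series_mul f h c + series_mul g h c); last by [].
have [mh mhP] := sublevel_finite_lb fh.
have [t ut tP] := sfin_range (wt w c - mh) ff.
have [t' ut' tP'] := sfin_range (wt w c - mh) fg.
have uniq_tt' : uniq (undup (t ++ t')) by exact: undup_uniq.
rewrite (@series_mulE f h c _ uniq_tt'); last first.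
  move=> a fa hca; rewrite mem_undup mem_cat tP//.
  by have := mhP _ hca; rewrite wtB; lra.
rewrite (@series_mulE g h c _ uniq_tt'); last first.
  move=> a ga hca; rewrite mem_undup mem_cat tP' ?orbT//.
  by have := mhP _ hca; rewrite wtB; lra.
rewrite (@series_mulE _ h c _ uniq_tt').
  by rewrite -big_split/=; apply: eq_bigr => a _; rewrite -mulrDl.
move=> a fga hca; have wa : wt w a <= wt w c - mh.
  by have := mhP _ hca; rewrite wtB; lra.
rewrite mem_undup mem_cat; have [fa|fa] := eqVneq (f a) 0; last by rewrite tP.
rewrite tP' ?orbT//; apply: contraNN fga => /eqP ga.
by rewrite (_ : (f + g) a = f a + g a)// fa ga addr0.
Qed.

Lemma sfin_one : sfin (@series_one n K).
Proof.
apply/finite_sublevel/(sub_finite_set _ (finite_set1 0)) => a.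
by rewrite /supp /series_one/=; have [->|_] := eqVneq a 0; rewrite //= eqxx.
Qed.

Lemma sfin_zero : sfin (0 : formal_series n K).
Proof.
apply/finite_sublevel/(sub_finite_set _ (@finite_set0 _)) => a.
by rewrite /supp/= eqxx.
Qed.

Definition sfin_pred : {pred formal_series n K} := fun f => `[< sfin f >].

Lemma sfin_predP f : reflect (sfin f) (f \in sfin_pred).
Proof. exact: asboolP. Qed.

Lemma sfin_zmod_closed : zmod_closed sfin_pred.
Proof.
split; first exact/sfin_predP/sfin_zero.
move=> f g /sfin_predP ff /sfin_predP fg; apply/sfin_predP.
exact/sfin_add/sfin_opp.
Qed.

HB.instance Definition _ :=
  GRing.isZmodClosed.Build (formal_series n K) sfin_pred sfin_zmod_closed.

Record fseries := Fseries {fseries_val :> formal_series n K;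
                           _ : fseries_val \in sfin_pred}.

HB.instance Definition _ := [isSub for fseries_val].
HB.instance Definition _ := [Choice of fseries by <:].
HB.instance Definition _ := [SubChoice_isSubZmodule of fseries by <:].

Lemma fseriesP (x : fseries) : sfin x.
Proof. by apply/sfin_predP; case: x. Qed.

Definition mk_fseries f (ff : sfin f) : fseries :=
  Fseries (introT (sfin_predP f) ff).

Definition fseries_one : fseries := mk_fseries sfin_one.
Definition fseries_mul (x y : fseries) : fseries :=
  mk_fseries (sfin_mul (fseriesP x) (fseriesP y)).

Lemma fseries_mulA : associative fseries_mul.
Proof. by move=> x y z; apply/val_inj/series_mulA; exact: fseriesP. Qed.

Lemma fseries_mulC : commutative fseries_mul.
Proof. by move=> x y; apply/val_inj/series_mulC. Qed.

Lemma fseries_mul1 : left_id fseries_one fseries_mul.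
Proof. by move=> x; apply/val_inj/series_mul1. Qed.

Lemma fseries_mulDl : left_distributive fseries_mul +%R.
Proof. by move=> x y z; apply/val_inj/series_mulDl; exact: fseriesP. Qed.

Lemma fseries_1neq0 : fseries_one != 0.
Proof.
apply/eqP => /(congr1 (fun x : fseries => fseries_val x 0)).
by rewrite /= /series_one eqxx => /eqP; rewrite oner_eq0.
Qed.

HB.instance Definition _ := GRing.Zmodule_isComNzRing.Build fseries
  fseries_mulA fseries_mulC fseries_mul1 fseries_mulDl fseries_1neq0.

Lemma fseries_sumE r (F : 'I_r -> fseries) c : 
  fseries_val (\sum_i F i) c = \sum_i fseries_val (F i) c.
Proof. by elim/big_ind2: _ => // x1 x2 y1 y2 <- <-. Qed.

Lemma fseries_expE (x : fseries) m :
  x ^+ m = series_exp x m :> formal_series n K.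
Proof.
elim: m => [|m IHm]; first by rewrite expr0.
by rewrite exprS /series_exp iterS -[iter _ _ _]/(series_exp x m) -IHm.
Qed.

(** The lexicographically least exponents [a] and [b] of the two supports form the only pair with
    sum [a + b], so the coefficient of the product there is a product of two nonzero scalars. *)
Lemma fseries_dom (x y : fseries) : x * y = 0 -> x = 0 \/ y = 0.
Proof.
move=> xy0; apply: contrapT => /not_orP[x0 y0].
have supp_neq0 (z : fseries) : z <> 0 -> supp z !=set0.
  move=> z0; apply/set0P/eqP => sz; apply: z0; apply/val_inj/funext => a /=.
  apply/eqP/negPn/negP => za; have : supp z a by [].
  by rewrite sz.
have [a la] := lexmin_neq0 (coords R n) (fseriesP x) (supp_neq0 _ x0).
have [b lb] := lexmin_neq0 (coords R n) (fseriesP y) (supp_neq0 _ y0).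
have xa := lexmin_sub la; have yb := lexmin_sub lb.
have : fseries_val (x * y) (a + b) = fseries_val x a * fseries_val y b.
  rewrite [LHS](@series_mulE _ _ _ [:: a])//.
    by rewrite big_seq1 (addrC a) addrK.
  move=> c xc yc; rewrite inE.
  have [|->//] := @lexmin_add _ _ [:: w] _ _ _ _ _ _ la lb xc yc.
  by rewrite addrC subrK.
rewrite xy0 => /esym/eqP; rewrite mulf_eq0.
by rewrite (negPf xa) (negPf yb).
Qed.

End SeriesRing.

(** * Rational scalars in characteristic zero and Euler derivations *)

Section RationalScalars.
Variables (K : fieldType) (charK : [pchar K] =i pred0).

Lemma intr_eq0_pchar0 (z : int) : (z%:~R == 0 :> K) = (z == 0).
Proof.
have nat0 m : (m%:R == 0 :> K) = (m == 0)%N by have /pcharf0P := charK; apply.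
case: z => m; first by rewrite -pmulrn nat0.
by rewrite NegzE mulrNz oppr_eq0 -pmulrn nat0.
Qed.

(** Computes [ratr x] from any fraction representing [x], reduced or not; a sum of two rationals is
    naturally given by an unreduced one. *)
Lemma ratr_mulzr_pchar0 (x : rat) (a b : int) :
  x * b%:~R = a%:~R -> ratr x * b%:~R = a%:~R :> K.
Proof.
have den0 : (denq x)%:~R != 0 :> K by rewrite intr_eq0_pchar0 denq_neq0.
rewrite -{1}(divq_num_den x) => xb.
have /eqP : ((numq x * b)%:~R : rat) = (a * denq x)%:~R.
  rewrite !intrM -xb mulrAC divfK//.
  by rewrite intr_eq0 denq_neq0.
rewrite eqr_int => /eqP eqab.
by rewrite /ratr mulrAC -intrM eqab intrM mulfK.
Qed.

Lemma ratrD_pchar0 (x y : rat) : ratr (x + y) = ratr x + ratr y :> K.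
Proof.
have den0 z : (denq z)%:~R != 0 :> K by rewrite intr_eq0_pchar0 denq_neq0.
have numQ z : z * (denq z)%:~R = (numq z)%:~R :> rat.
  by rewrite -{1}(divq_num_den z) divfK// intr_eq0 denq_neq0.
have num z : ratr z * (denq z)%:~R = (numq z)%:~R :> K.
  exact: ratr_mulzr_pchar0 (numQ z).
apply: (mulIf (den0 x)); apply: (mulIf (den0 y)).
rewrite -mulrA -intrM
  (@ratr_mulzr_pchar0 _ (numq x * denq y + numq y * denq x)).
  by rewrite intrD !intrM -!num; ring.
by rewrite intrD !intrM -!numQ; ring.
Qed.

Lemma ratr_inj_pchar0 : injective (@ratr K).
Proof.
move=> x y xy; apply/eqP; rewrite -subr_eq0 -numq_eq0 -intr_eq0_pchar0.
have : ratr (x - y) = 0 :> K.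
  by apply: (addIr (ratr y)); rewrite -ratrD_pchar0 subrK add0r.
move=> /eqP; rewrite /ratr mulf_eq0 invr_eq0 => /orP[//|].
by rewrite (intr_eq0_pchar0 (denq _)) (negPf (denq_neq0 _)).
Qed.

End RationalScalars.

Section EulerDerivation.
Variables (R : realType) (n : nat) (K : fieldType) (w : 'rV[R]_n).
Hypothesis charK : [pchar K] =i pred0.
Variable i : 'I_n.
Let FS := fseries K w.

(* The operator x_i d/dx_i. *)
Definition euler (f : formal_series n K) : formal_series n K :=
  fun a => ratr (a 0 i) * f a.

Lemma euler_neq0 f a : euler f a != 0 -> f a != 0.
Proof. by apply: contraNN => /eqP fa; rewrite /euler fa mulr0. Qed.

Lemma sfin_euler f : sfin w f -> sfin w (euler f).
Proof. by apply: sublevel_finite_sub => a /euler_neq0. Qed.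

Definition fseries_euler (x : FS) : FS := mk_fseries (sfin_euler (fseriesP x)).

Lemma fseries_eulerD (x y : FS) :
  fseries_euler (x + y) = fseries_euler x + fseries_euler y.
Proof. by apply/val_inj/funext => a; apply: mulrDr. Qed.

Lemma fseries_eulerM (x y : FS) :
  fseries_euler (x * y) = fseries_euler x * y + x * fseries_euler y.
Proof.
apply/val_inj/funext => c.
transitivity (series_mul (euler x) y c + series_mul x (euler y) c); last by [].
transitivity (ratr (c 0 i) * series_mul x y c); first by [].
have [m mP] := sublevel_finite_lb (fseriesP y).
have [s us sP] := sfin_range (wt w c - m) (fseriesP x).
have covers a : fseries_val x a != 0 -> fseries_val y (c - a) != 0 -> a \in s.
  by move=> xa yca; apply: sP => //; have := mP _ yca; rewrite wtB; lra.
rewrite (series_mulE us covers).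
rewrite (@series_mulE _ _ (euler x) y c s us); last first.
  by move=> a /euler_neq0 xa yca; apply: covers.
rewrite (@series_mulE _ _ x (euler y) c s us); last first.
  by move=> a xa /euler_neq0 yca; apply: covers.
rewrite mulr_sumr -big_split/=; apply: eq_bigr => a _.
rewrite /euler -{1}(subrK a c) [in LHS]mxE (ratrD_pchar0 charK); ring.
Qed.

Lemma iter_eulerE (x : FS) l a :
  fseries_val (iter l fseries_euler x) a = ratr (a 0 i) ^+ l * fseries_val x a.
Proof.
elim: l => [|l IHl] /=; first by rewrite expr0 mul1r.
by rewrite /euler IHl exprS mulrA.
Qed.

Definition power_fseries : set FS := [set x | power_series x].

Lemma power_fseries0 : power_fseries 0.
Proof. by move=> a; rewrite /supp/= eqxx. Qed.

Lemma power_fseries1 : power_fseries 1.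
Proof.
move=> a; rewrite /supp/= /series_one; have [->|_] := eqVneq a 0.
  by move=> _ j; rewrite mxE.
by rewrite eqxx.
Qed.

Lemma power_fseriesN x : power_fseries x -> power_fseries (- x).
Proof.
move=> px a xa; apply: px; apply: contraNN xa => /eqP xa.
by rewrite (_ : fseries_val (- x) a = - fseries_val x a)// xa oppr0.
Qed.

Lemma power_fseriesD x y :
  power_fseries x -> power_fseries y -> power_fseries (x + y).
Proof.
move=> px py a xya; have [xa|] := eqVneq (fseries_val x a) 0; last exact: px.
apply: py; apply: contraNN xya => /eqP ya.
rewrite (_ : fseries_val (x + y) a = fseries_val x a + fseries_val y a)//.
by rewrite xa ya addr0.
Qed.

Lemma power_fseriesM x y :
  power_fseries x -> power_fseries y -> power_fseries (x * y).
Proof.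
move=> px py a /series_mul_neq0[b [xb yab]] j.
rewrite -(subrK b a) mxE rpredD//; first exact: py.
exact: px.
Qed.

Lemma power_fseries_euler x :
  power_fseries x -> power_fseries (fseries_euler x).
Proof. by move=> px a /euler_neq0; apply: px. Qed.

Lemma fseries_natE m (a : 'rV[rat]_n) :
  fseries_val (m%:R : FS) a = m%:R * series_one K a.
Proof.
elim: m => [|m IHm]; first by rewrite mul0r.
rewrite -!natr1 mulrDl mul1r -IHm.
by [].
Qed.

Lemma fseries_pchar0 m : m.+1%:R <> 0 :> FS.
Proof.
move=> /(congr1 (fun x : FS => fseries_val x 0)); rewrite fseries_natE.
rewrite /series_one eqxx mulr1 => m0.
have : m.+1%:R == 0 :> K by apply/eqP.
by have /pcharf0P -> := charK.
Qed.

End EulerDerivation.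

(** * Recurrences for the coefficients of an algebraic series *)

Section Recurrence.
Variables (R : realType) (n : nat) (K : fieldType) (w : 'rV[R]_n).
Hypothesis charK : [pchar K] =i pred0.
Hypothesis power_sfin :
  forall f : formal_series n K, power_series f -> sfin w f.
Variable xi : formal_series n K.
Hypothesis xi_sfin : sfin w xi.
Hypothesis xi_alg : algebraic_series xi.

(* The coefficients of a linear differential equation
   \sum_q x^q p_q(x_i d/dx_i) xi = 0. *)
Lemma algebraic_recurrence (i : 'I_n) :
  exists p : 'rV[rat]_n -> {poly K},
    [/\ forall q, p q != 0 -> forall j, q 0 j \is a Num.nat,
        exists q, p q != 0
      & forall q v, p q != 0 -> xi v != 0 ->
          (forall q' v', p q' != 0 -> xi v' != 0 -> q' + v' = q + v ->
             q' = q) ->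
          root (p q) (ratr (v 0 i))].
Proof.
pose x : fseries K w := mk_fseries xi_sfin.
have [d [P [Ppow [i0 Pi0] Peval]]] := xi_alg.
pose P' j : fseries K w := mk_fseries (power_sfin (Ppow j)).
have [] := @algebraic_iter_theta _ (@power_fseries R n K w)
  (@fseries_dom R n K w) (@power_fseries0 R n K w) (@power_fseries1 R n K w)
  (@power_fseriesN R n K w) (@power_fseriesD R n K w) (@power_fseriesM R n K w)
  d P' x (@fseries_euler R n K w i).
- exact: fseries_pchar0.
- exact: fseries_eulerD.
- exact: fseries_eulerM.
- exact: power_fseries_euler.
- exact: Ppow.
- by exists i0 => /(congr1 (@fseries_val R n K w)).
- apply/val_inj/funext => c; rewrite -[RHS](congr1 (fun f => f c) Peval).
  rewrite [LHS]fseries_sumE /series_eval fct_sumE; apply: eq_bigr => j _.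
  by rewrite -[series_exp xi j](@fseries_expE _ _ _ w x j).
move=> r [c [Ac [l0 cl0] c0]].
(* Regroups the differential operator with coefficients [c l] by powers of x: [p q] is the
   polynomial in the derivation that multiplies x^q. *)
pose p q : {poly K} := \sum_(l < r) fseries_val (c l) q *: 'X^l.
have coefp q (l : 'I_r) : (p q)`_l = fseries_val (c l) q.
  rewrite coef_sum (bigD1 l)//= big1 ?addr0.
    by rewrite coefZ coefXn eqxx mulr1.
  move=> j jl; rewrite coefZ coefXn [_ == _](_ : _ = false) ?mulr0//.
  by apply/negbTE; rewrite eq_sym.
have p_neq0 q l : fseries_val (c l) q != 0 -> p q != 0.
  by apply: contraNN => /eqP pq; rewrite -coefp pq coef0.
exists p; split.
- move=> q pq; have [[l cl]|cq] := pselect (exists l, fseries_val (c l) q != 0).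
    exact: (Ac l).
  move/eqP: pq; case; rewrite /p big1// => l _.
  have [->|cl] := eqVneq (fseries_val (c l) q) 0; first by rewrite scale0r.
  by case: cq; exists l.
- apply: contrapT => /forallNP c_eq0; apply: cl0; apply/val_inj/funext => q.
  apply/eqP/negPn/negP => cq; apply: (c_eq0 q).
  exact: p_neq0 cq.
move=> q v pq xiv uniq_qv.
have := congr1 (fun y : fseries K w => fseries_val y (q + v)) c0.
rewrite fseries_sumE.
(* By uniqueness only the exponent [q] of [c l] contributes at [q + v], and the derivation
   multiplies x^v by its [i]-th exponent. *)
have term l : fseries_val (c l * iter l (@fseries_euler R n K w i) x) (q + v)
    = fseries_val (c l) q * ratr (v 0 i) ^+ l * xi v.
  rewrite [LHS](@series_mulE _ _ _ _ _ [:: q])//.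
    by rewrite big_seq1 iter_eulerE (addrC q) addrK mulrA.
  move=> a /p_neq0 pa; rewrite iter_eulerE mulf_eq0 negb_or => /andP[_ xia].
  by rewrite inE (uniq_qv _ _ pa xia)// addrC subrK.
under eq_bigr do rewrite term; rewrite -mulr_suml => /eqP.
rewrite mulf_eq0 (negPf xiv) orbF => /eqP sum0.
rewrite rootE /p horner_sum; apply/eqP; rewrite -[RHS]sum0.
by apply: eq_bigr => l _; rewrite hornerZ hornerXn.
Qed.

End Recurrence.

Lemma common_eps (R : realType) (m : nat) (P : 'I_m -> R -> Prop) :
  (forall j, exists2 e, 0 < e & forall t, 0 < t -> t <= e -> P j t) ->
  exists2 e, 0 < e & forall j t, 0 < t -> t <= e -> P j t.
Proof.
elim: m P => [|m IHm] P eP; first by exists 1 => // -[].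
have [e e0 eP'] := IHm (fun j => P (lift ord0 j)) (fun j => eP _).
have [f f0 fP] := eP ord0; exists (Num.min e f); first by rewrite lt_min e0.
move=> j t t0; rewrite le_min => /andP[te tf].
case: (unliftP ord0 j) => [j' ->|->]; first exact: eP'.
exact: fP.
Qed.

(** * Polyhedral cones and the interior of their duals *)

Section Dot.
Variables (R : realType) (n : nat).
Implicit Types (u v w : 'rV[R]_n).

Lemma dotC v w : dot v w = dot w v.
Proof. by apply: eq_bigr => i _; rewrite mulrC. Qed.

Lemma dotDl u v w : dot (u + v) w = dot u w + dot v w.
Proof.
by rewrite /dot -big_split/=; apply: eq_bigr => i _; rewrite mxE mulrDl.
Qed.

Lemma dotZl a v w : dot (a *: v) w = a * dot v w.
Proof.
by rewrite /dot mulr_sumr; apply: eq_bigr => i _; rewrite mxE mulrA.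
Qed.

Lemma dotDr u v w : dot w (u + v) = dot w u + dot w v.
Proof. by rewrite !(dotC w) dotDl. Qed.

Lemma dotZr a v w : dot w (a *: v) = a * dot w v.
Proof. by rewrite !(dotC w) dotZl. Qed.

Lemma dot0l w : dot 0 w = 0.
Proof. by rewrite -(scale0r 0) dotZl mul0r. Qed.

Lemma dot_suml m (g : 'I_m -> 'rV[R]_n) w :
  dot (\sum_j g j) w = \sum_j dot (g j) w.
Proof.
exact: (big_morph (fun v => dot v w) (fun u v => dotDl u v w) (dot0l w)).
Qed.

Lemma dot_gt0 v : v != 0 -> 0 < dot v v.
Proof.
move=> v0; have sq_ge0 i : true -> 0 <= v 0 i * v 0 i.
  by rewrite -expr2 sqr_ge0.
rewrite lt0r sumr_ge0// andbT; apply: contraNN v0 => /eqP dv0.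
apply/eqP/rowP => i; rewrite mxE.
have /eqP := psumr_eq0P sq_ge0 dv0 (i := i) isT.
by rewrite mulf_eq0 orbb => /eqP.
Qed.

Lemma dot_delta i w : dot (delta_mx 0 i) w = w 0 i.
Proof.
rewrite /dot (bigD1 i)//= mxE !eqxx mul1r big1 ?addr0// => j /negPf ji.
by rewrite mxE ji andbF mul0r.
Qed.

(* Gordan's alternative. In the inductive step one projects along the first
   vector g0: a relation between the projections either is a relation between
   the vectors or exhibits g0 as a positive combination of the others. *)
Lemma gordan m (g : 'I_m -> 'rV[R]_n) :
  (forall c : 'I_m -> R, (forall j, 0 <= c j) -> \sum_j c j *: g j = 0 ->
     forall j, c j *: g j = 0) ->
  exists w, forall j, g j != 0 -> 0 < dot (g j) w.
Proof.
elim: m g => [|m IHm] g pointed; first by exists 0 => -[].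
pose g0 := g ord0; pose g' j := g (lift ord0 j).
have pointed' (a : R) (c : 'I_m -> R) : 0 <= a -> (forall j, 0 <= c j) ->
    a *: g0 + \sum_j c j *: g' j = 0 -> forall j, c j *: g' j = 0.
  move=> a0 c0 ac0 j.
  have := pointed (fun j => if unlift ord0 j is Some j' then c j' else a).
  rewrite big_ord_recl unlift_none.
  under eq_bigr do rewrite liftK.
  move=> /(_ _ ac0 (lift ord0 j)); rewrite liftK; apply.
  by move=> j'; case: unlift.
have [w wP] : exists w, forall j, g' j != 0 -> 0 < dot (g' j) w.
  apply: IHm => c c0 cg; apply: (pointed' 0) => //.
  by rewrite scale0r add0r.
have [g00|g0n0] := eqVneq g0 0.
  exists w => j; case: (unliftP ord0 j) => [j' ->|->]; first exact: wP.
  by rewrite -[g ord0]/g0 g00 eqxx.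
have dg0 := dot_gt0 g0n0.
pose r j := dot (g' j) g0 / dot g0 g0.
pose h j := g' j - r j *: g0.
have [pointed_h|] := pselect (forall c : 'I_m -> R, (forall j, 0 <= c j) ->
    \sum_j c j *: h j = 0 -> forall j, c j *: h j = 0); last first.
  move=> /existsNP[c /not_implyP[c0 /not_implyP[ch /existsNP[j0 chj0]]]].
  pose k := \sum_j c j * r j.
  have cg : \sum_j c j *: g' j = k *: g0.
    apply/eqP; rewrite -subr_eq0 scaler_suml -sumrB; apply/eqP.
    by rewrite -[RHS]ch; apply: eq_bigr => j _; rewrite scalerBr scalerA.
  have [k_le0|k_gt0] := leP k 0.
    have := pointed' (- k) c; rewrite oppr_ge0 cg scaleNr addNr.
    move=> /(_ k_le0 c0 erefl j0) /eqP; rewrite scaler_eq0 => /orP[|]/eqP e.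
      by case: chj0; rewrite e scale0r.
    by case: chj0; rewrite /h /r e dot0l mul0r scale0r subr0 scaler0.
  have hj0 : h j0 != 0 by apply/eqP => e; apply: chj0; rewrite e scaler0.
  have gj0 : g' j0 != 0.
    by apply: contraNN hj0 => /eqP e; rewrite /h /r e dot0l mul0r scale0r subr0.
  have cj0 : 0 < c j0.
    by rewrite lt0r c0 andbT; apply/eqP => e; apply: chj0; rewrite e scale0r.
  exists w => j; case: (unliftP ord0 j) => [j' ->|-> _]; first exact: wP.
  rewrite -(pmulr_rgt0 _ k_gt0) -dotZl -[g ord0]/g0 -cg dot_suml (bigD1 j0)//=.
  rewrite ltr_wpDr//; last by rewrite dotZl mulr_gt0// wP.
  rewrite sumr_ge0// => i _; rewrite dotZl mulr_ge0//.
  by have [->|/wP/ltW//] := eqVneq (g' i) 0; rewrite dot0l.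
have [w' w'P] := IHm h pointed_h.
(* The part of [w'] orthogonal to [g0]: it pairs with [g' j] as [w'] does with [h j]. A small
   positive multiple of [g0] is added to it later to be positive on [g0] as well. *)
pose w'' := w' - (dot w' g0 / dot g0 g0) *: g0.
have g'w'' j : dot (g' j) w'' = dot (h j) w'.
  rewrite /w'' /h dotDr dotDl -!(scaleNr _ g0) dotZr dotZl /r (dotC w').
  by field; rewrite gt_eqF.
have g0w'' : dot g0 w'' = 0.
  by rewrite /w'' dotDr -(scaleNr _ g0) dotZr (dotC w'); field; rewrite gt_eqF.
have [e e0 eP] : exists2 e, 0 < e & forall j t, 0 < t -> t <= e ->
    h j != 0 -> 0 < dot (h j) w' + t * dot (g' j) g0.
  apply: common_eps => j; have [hj|hj] := eqVneq (h j) 0; first by exists 1.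
  have hw := w'P _ hj; pose b := `|dot (g' j) g0| + 1.
  have b0 : 0 < b by rewrite ltr_wpDl.
  exists (dot (h j) w' / b); first by rewrite divr_gt0.
  move=> t t0; rewrite ler_pdivlMr// => tb _.
  have : - (t * dot (g' j) g0) <= t * `|dot (g' j) g0|.
    by rewrite -mulrN ler_pM2l// -normrN ler_norm.
  by move: tb; rewrite /b mulrDr mulr1; lra.
exists (w'' + e *: g0) => j.
case: (unliftP ord0 j) => [j' ->|-> _]; last first.
  by rewrite dotDr g0w'' add0r dotZr mulr_gt0.
rewrite -[g (lift _ _)]/(g' j') dotDr dotZr g'w'' => gj0.
have [hj|hj] := eqVneq (h j') 0; last exact: eP.
rewrite hj dot0l add0r mulr_gt0//.
(* Here [g' j'] is a multiple of [g0], and the factor is positive: a negative one would give a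
   nontrivial relation with nonnegative coefficients. *)
move/eqP: hj; rewrite subr_eq0 => /eqP gr.
have r0 : r j' != 0 by apply: contraNN gj0 => /eqP r0; rewrite gr r0 scale0r.
rewrite gr dotZl mulr_gt0// lt0r r0/= leNgt; apply/negP => r_lt0.
have := pointed' (- r j') (fun j => if j == j' then 1 else 0).
rewrite (bigD1 j')//= eqxx big1 ?addr0; last first.
  by move=> i /negPf ->; rewrite scale0r.
rewrite scale1r gr scaleNr addNr oppr_ge0 => /(_ (ltW r_lt0) _ erefl j').
rewrite eqxx scale1r => g'0; move/eqP: gj0; apply; apply: g'0 => i.
by case: ifP.
Qed.

(** A relation with [c j > 0] makes [- g j] a nonnegative combination of the other generators, so
    the cone contains the line spanned by [g j], which forces [g j = 0]. Gordan's alternative then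
    applies. *)
Lemma strongly_convex_dual_interior m (g : 'I_m -> 'rV[R]_n) :
  strongly_convex [set v | exists2 c : 'I_m -> R,
                     (forall j, 0 <= c j) & v = \sum_j c j *: g j] ->
  exists w, forall j, g j != 0 -> 0 < dot (g j) w.
Proof.
move=> sconv; apply: gordan => c c0 cg j.
have [->|cj] := eqVneq (c j) 0; first by rewrite scale0r.
have cj0 : 0 < c j by rewrite lt0r cj c0.
suff -> : g j = 0 by rewrite scaler0.
suff : <[g j]>%VS = 0%VS.
  by move=> /eqP; rewrite -dimv_eq0 dim_vline eqb0 negbK => /eqP.
apply: sconv => v /= /vlineP[a ->].
have [a0|/ltW a0] := leP 0 a.
  exists (fun i => if i == j then a else 0); first by move=> i; case: ifP.
  rewrite (bigD1 j)//= eqxx big1 ?addr0// => i /negPf ->.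
  by rewrite scale0r.
exists (fun i => (if i == j then 0 else - a / c j * c i)).
  move=> i; case: ifP => // _; by rewrite mulr_ge0// divr_ge0// oppr_ge0.
rewrite (bigD1 j)//= eqxx scale0r add0r.
have : \sum_(i | i != j) c i *: g i = - (c j *: g j).
  by move: cg; rewrite (bigD1 j)//= addrC => /eqP; rewrite addr_eq0 => /eqP.
move=> /(congr1 (fun v => (- a / c j) *: v)).
rewrite scaler_sumr scalerN scalerA.
rewrite divfK// scaleNr opprK => <-.
by apply: eq_bigr => i /negPf ->; rewrite scalerA.
Qed.

Section Cone.
Variables (m : nat) (g : 'I_m -> 'rV[R]_n) (w : 'rV[R]_n).
Hypothesis gw : forall j, g j != 0 -> 0 < dot (g j) w.

Lemma gen_dot_ge0 j : 0 <= dot (g j) w.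
Proof. by have [->|/gw/ltW//] := eqVneq (g j) 0; rewrite dot0l. Qed.

Lemma cone_dot_gt0 (c : 'I_m -> R) : (forall j, 0 <= c j) ->
  \sum_j c j *: g j != 0 -> 0 < dot (\sum_j c j *: g j) w.
Proof.
move=> c0 cg; have [/existsP[j cgj]|] := boolP [exists j, c j *: g j != 0].
  rewrite dot_suml (bigD1 j)//= ltr_wpDr//.
    by rewrite sumr_ge0// => i _; rewrite dotZl mulr_ge0 ?gen_dot_ge0.
  move: cgj; rewrite scaler_eq0 negb_or => /andP[cj gj].
  by rewrite dotZl mulr_gt0 ?gw// lt0r cj c0.
rewrite negb_exists => /forallP cg0; move/eqP: cg; case.
by rewrite big1// => j _; apply/eqP; rewrite -[_ == _]negbK.
Qed.

End Cone.
End Dot.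

(** * Finiteness of sets of lattice points and of roots *)

Lemma bounded_lattice_finite (R : realType) (n k : nat) (M : R) : (0 < k)%N ->
  finite_set [set a : 'rV[rat]_n |
    forall i, k%:R * a 0 i \is a Num.int /\ `|ratr (a 0 i)| <= M :> R].
Proof.
move=> k0; pose N := Num.truncn (k%:R * M).
pose f (t : {ffun 'I_n -> 'I_(N.*2.+1)}) : 'rV[rat]_n :=
  \row_i (((t i)%:R - N%:R) / k%:R).
apply: (@sub_finite_set _ _ (f @` setT)); last first.
  by apply: finite_image; apply: finite_finset.
move=> a aP.
have kK : (k%:R : rat) != 0 by rewrite pnatr_eq0 -lt0n.
have bound i : exists z : int, k%:R * a 0 i = z%:~R /\ (`|z| <= N)%N.
  have [/intrP[z az] aM] := aP i; exists z; split=> //.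
  have : `|z|%:R <= k%:R * M :> R.
    have -> : `|z|%:R = k%:R * `|ratr (a 0 i)| :> R.
      have : k%:R * ratr (a 0 i) = z%:~R :> R.
        by rewrite -(ratr_nat R) -rmorphM/= az ratr_int.
      move=> /(congr1 Num.norm); rewrite normrM normr_nat => ->.
      by rewrite -intr_norm -abszE.
    by rewrite ler_pM2l ?ltr0n.
  move=> zM; rewrite /N truncn_ge_nat//; exact: le_trans zM.
have /choice[z zP] := bound.
exists [ffun i => inord (absz (z i + N%:Z))] => //.
apply/rowP => i; rewrite mxE ffunE; have [az zN] := zP i.
have zN0 : 0 <= z i + N%:Z.
  by lia.
rewrite inordK; last by lia.
have -> : (absz (z i + N%:Z))%:R = (z i)%:~R + N%:R :> rat.
  by rewrite -[LHS]/((absz (z i + N%:Z))%:Z%:~R) gez0_abs// intrD.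
rewrite addrK -az.
by rewrite mulrC mulKf.
Qed.

Section SublevelFiniteness.
Variables (R : realType) (n : nat).

(** Nonzero generators have positive weight, so a bound on the weight bounds their coefficients and
    then the coordinates; only finitely many lattice points are left. *)
Lemma cone_sublevel_finite (m k : nat) (g : 'I_m -> 'rV[R]_n)
    (s w : 'rV[R]_n) (B : set 'rV[rat]_n) : (0 < k)%N ->
  (forall j, g j != 0 -> 0 < dot (g j) w) ->
  (forall a, B a -> forall i, k%:R * a 0 i \is a Num.int) ->
  (forall a, B a -> exists2 c : 'I_m -> R, (forall j, 0 <= c j) &
     map_mx ratr a = s + \sum_j c j *: g j) ->
  sublevel_finite w B.
Proof.
move=> k0 gw Bint Bcone C.
pose D := `|C - dot s w|.
pose M := \sum_i (`|s 0 i| + \sum_j D / dot (g j) w * `|g j 0 i|).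
have term_ge0 i : 0 <= `|s 0 i| + \sum_j D / dot (g j) w * `|g j 0 i|.
  rewrite addr_ge0// sumr_ge0// => j _.
  by rewrite mulr_ge0// divr_ge0 ?normr_ge0 ?(gen_dot_ge0 gw).
apply: sub_finite_set (@bounded_lattice_finite R n k M k0) => a [Ba /= aC] i.
split; first exact: Bint.
have [c c0 ac] := Bcone _ Ba.
have cD j : c j * dot (g j) w <= D.
  apply: le_trans (ler_norm _); rewrite lerBrDl; apply: le_trans aC.
  rewrite /wt ac dotDl lerD2l dot_suml (bigD1 j)//= dotZl lerDl.
  by rewrite sumr_ge0// => j' _; rewrite dotZl mulr_ge0 ?(gen_dot_ge0 gw).
have -> : ratr (a 0 i) = s 0 i + \sum_j c j * g j 0 i :> R.
  have := congr1 (fun v : 'rV[R]_n => v 0 i) ac; rewrite !mxE => ->.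
  by rewrite summxE; congr (_ + _); apply: eq_bigr => j _; rewrite mxE.
apply: le_trans (_ : _ <= `|s 0 i| + \sum_j D / dot (g j) w * `|g j 0 i|) _.
  apply: le_trans (ler_normD _ _) _; rewrite lerD2l.
  apply: le_trans (ler_norm_sum _ _ _) _; apply: ler_sum => j _.
  rewrite normrM (ger0_norm (c0 j)).
  have [->|gj] := eqVneq (g j) 0; first by rewrite mxE normr0 !mulr0.
  by rewrite ler_wpM2r// ler_pdivlMr ?gw.
by rewrite /M (bigD1 i)//= lerDl sumr_ge0.
Qed.

Lemma wt_nat_ge0 (w : 'rV[R]_n) (q : 'rV[rat]_n) :
  (forall j, 0 <= w 0 j) -> (forall j, q 0 j \is a Num.nat) -> 0 <= wt w q.
Proof.
move=> w0 qnat; rewrite wtE sumr_ge0// => j _; rewrite mulr_ge0//.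
by have /natrP[m ->] := qnat j; rewrite ratr_nat.
Qed.

Lemma wt_nat_le (w w' : 'rV[R]_n) (q : 'rV[rat]_n) :
  (forall j, w 0 j <= w' 0 j) -> (forall j, q 0 j \is a Num.nat) ->
  wt w q <= wt w' q.
Proof.
move=> ww' qnat; rewrite !wtE ler_sum// => j _; rewrite ler_wpM2l//.
by have /natrP[m ->] := qnat j; rewrite ratr_nat.
Qed.

Lemma nat_sublevel_finite (w : 'rV[R]_n) : (forall i, 0 < w 0 i) ->
  sublevel_finite w [set q | forall i, q 0 i \is a Num.nat].
Proof.
move=> w0 C; pose M := \sum_i `|C / w 0 i|.
apply: sub_finite_set (@bounded_lattice_finite R n 1 M isT) => q [qnat /= qC] i.
split; first by rewrite mul1r intr_nat.
have q_ge0 j : 0 <= ratr (q 0 j) :> R.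
  by have /natrP[m ->] := qnat j; rewrite ratr_nat.
rewrite ger0_norm//; apply: le_trans (_ : _ <= `|C / w 0 i|) _; last first.
  by rewrite /M (bigD1 i)//= lerDl sumr_ge0.
apply: le_trans (ler_norm _); rewrite ler_pdivlMr//; apply: le_trans qC.
rewrite wtE (bigD1 i)//= lerDl sumr_ge0// => j _; rewrite mulr_ge0//.
exact: ltW.
Qed.

Lemma finite_row_product (C : 'I_n -> set rat) :
  (forall i, finite_set (C i)) ->
  finite_set [set v : 'rV[rat]_n | forall i, C i (v 0 i)].
Proof.
move=> finC; have /choice[s sP] : forall i, exists s : seq rat, C i = [set` s].
  by move=> i; apply/finite_seqP.
pose N := \max_i size (s i).
pose f (t : {ffun 'I_n -> 'I_N.+1}) : 'rV[rat]_n := \row_i nth 0 (s i) (t i).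
apply: (@sub_finite_set _ _ (f @` setT)); last first.
  by apply: finite_image; apply: finite_finset.
move=> v vP; exists [ffun i => inord (index (v 0 i) (s i))] => //.
apply/rowP => i; have := vP i; rewrite sP /= => vs.
rewrite mxE ffunE inordK ?nth_index//.
apply: leq_trans (_ : size (s i) < N.+1)%N; first by rewrite ltnS index_size.
by rewrite ltnS /N (leq_bigmax i).
Qed.

End SublevelFiniteness.

Lemma finite_rational_roots (K : fieldType) (charK : [pchar K] =i pred0)
    (p : {poly K}) : p != 0 -> finite_set [set x : rat | root p (ratr x)].
Proof.
move=> p0; apply: contrapT => /(infinite_set_fset (size p))[X XP sX].
suff : (size [seq (ratr x : K) | x <- finmap.enum_fset X] < size p)%N.
  by rewrite size_map ltnNge sX.
apply: max_poly_roots => //; last first.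
  by rewrite map_inj_uniq ?finmap.fset_uniq//; apply: ratr_inj_pchar0.
by apply/allP => y /mapP[x xX ->]; apply: (XP x).
Qed.

(** * Exceptional exponents and the levels of the support *)

Section Levels.
Variables (R : realType) (n : nat) (K : fieldType).
Hypothesis charK : [pchar K] =i pred0.
Variables (B : set 'rV[rat]_n) (p : 'I_n -> 'rV[rat]_n -> {poly K}).
Variables (u w : 'rV[R]_n).
Hypothesis u_gt0 : forall j, 0 < u 0 j.
Hypothesis w_gt0 : forall j, 0 < w 0 j.
Hypothesis w_fin : sublevel_finite w B.

Let Q i : set 'rV[rat]_n := [set q | p i q != 0].
Let Q0 i := argmin u (Q i).

Hypothesis Qnat : forall i q, Q i q -> forall j, q 0 j \is a Num.nat.
Hypothesis Qn0 : forall i, Q i !=set0.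
Hypothesis Broot : forall i q v, Q i q -> B v ->
  (forall q' v', Q i q' -> B v' -> q' + v' = q + v -> q' = q) ->
  root (p i q) (ratr (v 0 i)).

(** Only the finitely many exponents of least [u]-weight are allowed for [q], so that each
    coordinate is a root of one of finitely many nonzero polynomials. *)
Definition exceptional : set 'rV[rat]_n :=
  [set v | forall i, exists2 q, Q0 i q & root (p i q) (ratr (v 0 i))].

Let Q_fin i (v : 'rV[R]_n) : (forall j, 0 < v 0 j) -> sublevel_finite v (Q i).
Proof.
by move=> v0; apply: sublevel_finite_sub (nat_sublevel_finite v0); apply: Qnat.
Qed.

Let Q0n0 i : Q0 i !=set0.
Proof. exact: argmin_neq0 (Q_fin i u_gt0) (Qn0 i). Qed.

Let Q0_fin i : finite_set (Q0 i).
Proof. exact: argmin_finite (Q_fin i u_gt0). Qed.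

Let Q0_wt i q q' : Q0 i q -> Q0 i q' -> wt u q = wt u q'.
Proof. by move=> [Qq qm] [Qq' qm']; apply/eqP; rewrite eq_le qm ?qm'. Qed.

Lemma exceptional_finite : finite_set exceptional.
Proof.
pose C i := \bigcup_(q in Q0 i) [set x : rat | root (p i q) (ratr x)].
apply: sub_finite_set (@finite_row_product n C _) => [v Ev i|i].
  by have [q ? ?] := Ev i; exists q.
apply: bigcup_finite => // q [pq _]; exact: finite_rational_roots.
Qed.

Let exceptionalI v : B v -> (forall i, exists2 q, Q0 i q &
    forall q' v', Q i q' -> B v' -> q' + v' = q + v -> q' = q) -> exceptional v.
Proof.
move=> Bv uniq_v i; have [q Q0q uq] := uniq_v i; exists q => //.
by apply: Broot => //; case: Q0q.
Qed.

(** The non-initial exponents of each recurrence are sublevel finite for [u], so their least weight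
    is attained and exceeds the initial one; the finitely many [i] share a bound. *)
Lemma initial_gap : exists2 d, 0 < d & forall i q q0, Q0 i q0 -> Q i q ->
  ~ Q0 i q -> wt u q0 + d <= wt u q.
Proof.
suff [d d0 dP] : exists2 d, 0 < d & forall i t, 0 < t -> t <= d ->
    forall q q0, Q0 i q0 -> Q i q -> ~ Q0 i q -> wt u q0 + t <= wt u q.
  by exists d => // i; apply: dP.
apply: common_eps => i; have [q0 Q0q0] := Q0n0 i.
have [Q'0|/set0P Q'n0] := eqVneq (Q i `\` Q0 i) set0.
  exists 1 => // t _ _ q q' _ Qq Q0q.
  by have : (Q i `\` Q0 i) q by []; rewrite Q'0.
have [|x [[Qx Q0x] xmin]] := argmin_neq0 _ Q'n0 (w := u).
  by apply: sublevel_finite_sub (Q_fin i u_gt0) => q [].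
exists (wt u x - wt u q0).
  rewrite subr_gt0 ltNge; apply/negP => xq0; apply: Q0x; split=> // q Qq.
  by apply: le_trans xq0 _; case: Q0q0 => _; apply.
move=> t t0 tx q q1 Q0q1 Qq Q0q; rewrite (Q0_wt Q0q1 Q0q0).
have := xmin q (conj Qq Q0q); lra.
Qed.

(** Closeness to [u] is measured by ratios: the exponents [q] being nonnegative, their weights
    change by a factor between [1 - e] and [1 + e], and the gap survives for small [e]. *)
Lemma initial_stable : exists2 e, 0 < e < 1 & forall i (v : 'rV[R]_n),
  (forall j, (1 - e) * u 0 j <= v 0 j <= (1 + e) * u 0 j) ->
  forall q q0, Q0 i q0 -> Q i q -> ~ Q0 i q -> wt v q0 < wt v q.
Proof.
have [d d0 dP] := initial_gap.
suff [e e0 eP] : exists2 e, 0 < e & forall i t, 0 < t -> t <= e -> t < 1 /\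
    forall q q0, Q0 i q0 -> Q i q -> ~ Q0 i q ->
    (1 + t) * wt u q0 < (1 - t) * wt u q.
  exists (Num.min e 2^-1).
    by rewrite lt_min e0 invr_gt0 ltr0n/= gt_min invf_lt1// ltr1n orbT.
  have m0 : 0 < Num.min e 2^-1 by rewrite lt_min e0 invr_gt0 ltr0n.
  have le_me : Num.min e 2^-1 <= e by rewrite ge_min lexx.
  move=> i v vu q q0 Q0q0 Qq Q0q.
  have [_ /(_ _ _ Q0q0 Qq Q0q)] := eP i (Num.min e 2^-1) m0 le_me.
  move: (Num.min _ _) vu => t vu lt_t.
  apply: le_lt_trans (_ : _ <= (1 + t) * wt u q0) (lt_le_trans lt_t _).
    rewrite -wt_scalew; apply: wt_nat_le => [j|].
      by rewrite mxE; case/andP: (vu j).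
    by apply: (@Qnat i); case: Q0q0.
  rewrite -wt_scalew; apply: wt_nat_le => [j|].
    by rewrite mxE; case/andP: (vu j).
  exact: (@Qnat i).
apply: common_eps => i; have [q1 Q0q1] := Q0n0 i.
have e_ge0 : 0 <= wt u q1.
  apply: wt_nat_ge0 => [j|]; first exact: ltW.
  by apply: (@Qnat i); case: Q0q1.
(* With [m = wt u q1], the inequality [(1 + t) * m < (1 - t) * (m + d)] means [t * (2 * m + d) < d];
   the added 1 makes it strict. *)
have den_gt0 : 0 < 2 * wt u q1 + d + 1 by lra.
exists (d / (2 * wt u q1 + d + 1)); first by rewrite divr_gt0.
move=> t t0; rewrite ler_pdivlMr// => td.
have t1 : t < 1.
  rewrite ltNge; apply/negP => t1.
  have : 1 * (2 * wt u q1 + d + 1) <= t * (2 * wt u q1 + d + 1).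
    by rewrite ler_pM2r.
  lra.
split=> // q q0 Q0q0 Qq Q0q; rewrite (Q0_wt Q0q0 Q0q1).
have := dP _ _ _ Q0q1 Qq Q0q => le_q.
apply: lt_le_trans (_ : _ < (1 - t) * (wt u q1 + d)) _.
  by nra.
by rewrite ler_pM2l ?subr_gt0.
Qed.

(* If B is sublevel finite for u + t w then its minimum for this weight is
   exceptional, hence bounded independently of t. *)
Lemma weight_bounded_below :
  (forall t, 0 < t -> sublevel_finite (u + t *: w) B) ->
  exists b, forall v, B v -> b <= wt u v.
Proof.
move=> fin_t; have [e /andP[e0 _] eP] := initial_stable.
have [b bP] := sublevel_finite_lb (finite_sublevel u exceptional_finite).
have [c cP] := sublevel_finite_lb (finite_sublevel w exceptional_finite).
exists b => v Bv; rewrite leNgt; apply/negP => vb.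
have [l l0 lP] : exists2 l, 0 < l & forall j t, 0 < t -> t <= l ->
    t * w 0 j <= e * u 0 j.
  apply: common_eps => j; exists (e * u 0 j / w 0 j).
    by rewrite divr_gt0// mulr_gt0.
  by move=> t _; rewrite ler_pdivlMr.
(* The minimum [x] found below satisfies [b - wt u v <= t * (wt w v - c)], which is contradicted by
   [t * d <= b - wt u v]. The bound [l] keeps [u + t *: w] in the range of stability. *)
pose d := `|wt w v - c| + 1.
have d0 : 0 < d by rewrite ltr_wpDl.
pose t := Num.min l ((b - wt u v) / d).
have t0 : 0 < t by rewrite lt_min l0 divr_gt0// subr_gt0.
have tl : t <= l by rewrite ge_min lexx.
have td : t * d <= b - wt u v by rewrite -ler_pdivlMr// ge_min lexx orbT.
pose ut := u + t *: w.
have ut_gt0 j : 0 < ut 0 j by rewrite !mxE addr_gt0// mulr_gt0.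
have ut_near j : (1 - e) * u 0 j <= ut 0 j <= (1 + e) * u 0 j.
  have eu : 0 < e * u 0 j by rewrite mulr_gt0.
  have tw : 0 < t * w 0 j by rewrite mulr_gt0.
  have := lP j t t0 tl => twe; rewrite !mxE mulrBl mulrDl !mul1r.
  by apply/andP; split; lra.
have [|x lx] := @lexmin_neq0 R n ut (coords R n) B (fin_t _ t0).
  by exists v.
have [Bx xmin] := lexmin_argmin lx.
have Ex : exceptional x.
  apply: exceptionalI => // i.
  have [q lq] := lexmin_neq0 (coords R n) (Q_fin i ut_gt0) (Qn0 i).
  have [Qq qmin] := lexmin_argmin lq.
  exists q.
    apply: contrapT => Q0q; have [q0 Q0q0] := Q0n0 i.
    have := eP i ut ut_near _ _ Q0q0 Qq Q0q.
    by rewrite ltNge qmin//; case: Q0q0.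
  move=> q' v' Qq' Bv'.
  by move=> /(@lexmin_add _ _ [:: ut] _ _ _ _ _ _ lq lx Qq' Bv')[].
have := xmin _ Bv; rewrite !wt_addw !wt_scalew.
have := bP _ Ex; have := cP _ Ex => cx bx le_xv.
have : t * (wt w v - c) <= t * `|wt w v - c|.
  by rewrite ler_pM2l// ler_norm.
have : t * c <= t * wt w x by rewrite ler_pM2l.
move: td; rewrite /d mulrDr mulr1 mulrBr; lra.
Qed.

(** Let [T] be the supremum of the weights below which [B] is finite. The window of half-width
    [d / 2] around [T] holds infinitely many points of [B] but meets finitely many levels, so there
    is a least infinite level. *)
Lemma exists_infinite_level (b : R) :
  (forall v, B v -> b <= wt u v) -> ~ sublevel_finite u B ->
  exists s, finite_set (B `&` [set v | wt u v < s]) /\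
            infinite_set (B `&` [set v | wt u v = s]).
Proof.
move=> bP /existsNP[C infC].
pose A : set R := [set t | finite_set (B `&` [set v | wt u v < t])].
have A_ub : ubound A C.
  move=> t At; rewrite leNgt; apply/negP => Ct; apply: infC.
  apply: sub_finite_set At => v [Bv /= vC].
  by split=> //=; apply: le_lt_trans Ct.
have A_b : A b.
  apply: sub_finite_set (@finite_set0 _) => v [Bv /=].
  by rewrite ltNge bP.
have supA : has_sup A by split; [exists b|exists C].
pose T := sup A.
have [d d0 dP] := initial_gap.
pose W := B `&` [set v | wt u v < T - d / 2].
have finW : finite_set W.
  have [|t At Tt] := sup_adherent _ supA (eps := d / 2).
    by rewrite divr_gt0.
  by apply: sub_finite_set At => v [Bv /= vT]; split=> //=; apply: lt_trans Tt.
have infT : infinite_set (B `&` [set v | wt u v < T + d / 2]).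
  move=> finT; have : T + d / 2 <= T by apply: ub_le_sup => //; exists C.
  by rewrite gerDl leNgt divr_gt0.
pose level s := B `&` [set v | wt u v = s].
pose L := [set s | [/\ T - d / 2 <= s, s < T + d / 2 & level s !=set0]].
have /choice[m mP] : forall i, exists m, forall q, Q0 i q -> wt u q = m.
  by move=> i; have [q Qq] := Q0n0 i; exists (wt u q) => q' /Q0_wt; apply.
(* If [q + x = q' + v] with [q] initial, [q'] not and [x] in the window, then [q'] weighs at least
   [d] more than [q], which pushes [v] below the window, into the finite set [W]; the lower bound
   [b] for [v] in turn bounds the weight of [q']. *)
pose F i := [set x - q | x in [set q' + v | q' in
    Q i `&` [set q | wt u q <= m i + (T + d / 2) - b] & v in W] & q in Q0 i].
have finF : finite_set (exceptional `|` \bigcup_i F i).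
  rewrite finite_setU; split; first exact: exceptional_finite.
  apply: bigcup_finite => [|i _]; first exact: finite_finset.
  apply: finite_image2; last exact: Q0_fin.
  by apply: finite_image2 => //; apply: Q_fin.
have finL : finite_set L.
  apply: sub_finite_set (finite_image (wt u) finF) => s [Ts sT sn0].
  have [|x lx] := lexmin_neq0 (coords R n) _ sn0 (w := w).
    by apply: sublevel_finite_sub w_fin => v [].
  have [Bx xs] := lexmin_sub lx.
  exists x => //; apply: contrapT => /not_orP[Ex Fx]; apply: Ex.
  apply: exceptionalI => // i.
  have [q lq] := lexmin_finite_neq0 (w :: coords R n) (Q0_fin i) (Q0n0 i).
  have Q0q := lexmin_sub lq; exists q => // q' v Qq' Bv eqv.
  have wt_eq : wt u q' + wt u v = wt u q + wt u x by rewrite -!wtD eqv.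
  (* An initial [q'] keeps [v] on the level of [x], where [lexmin_add] applies; any other [q'] would
     put [x] in [F i]. *)
  have [Q0q'|Q0q'] := pselect (Q0 i q').
    have sv : level s v.
      by split=> //=; move: wt_eq; rewrite (Q0_wt Q0q' Q0q) => /addrI ->.
    by have [] := @lexmin_add _ _ [:: w] _ _ _ _ _ _ lq lx Q0q' sv eqv.
  case: Fx; exists i => //; exists (q' + v); last first.
    by exists q => //; rewrite eqv addrC addKr.
  have mq := mP _ _ Q0q; have dq := dP _ _ _ Q0q Qq' Q0q'.
  have bv := bP _ Bv.
  exists q'; first by split=> //=; move: wt_eq; rewrite xs; lra.
  by exists v => //; split=> //=; move: wt_eq; rewrite xs; lra.
(* If every level in the window were finite, their finite union with [W] would contradict [infT]. *)
have [s [Ls infs] smin] : exists2 s, L s /\ infinite_set (level s) &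
    forall s', L s' /\ infinite_set (level s') -> s <= s'.
  apply: (finite_argmin id).
    by apply: sub_finite_set finL => s [].
  apply: contrapT => noinf; apply: infT.
  apply: sub_finite_set (_ : finite_set (W `|` \bigcup_(s in L) level s)).
    move=> v [Bv /= vT].
    have [vW|Wv] := ltP (wt u v) (T - d / 2); first by left.
    by right; exists (wt u v) => //; split=> //; exists v.
  rewrite finite_setU; split=> //; apply: bigcup_finite => // s Ls.
  by apply: contrapT => infs; apply: noinf; exists s.
exists s; split=> //.
apply: sub_finite_set (_ : finite_set
    (W `|` \bigcup_(s' in L `&` [set s' | s' < s]) level s')).
  move=> v [Bv /= vs]; have [vW|Wv] := ltP (wt u v) (T - d / 2); first by left.
  right; exists (wt u v) => //; split=> //; split=> //; last by exists v.
  by apply: lt_trans vs _; case: Ls.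
rewrite finite_setU; split=> //.
apply: bigcup_finite => [|s' [Ls' /= s's]]; first exact: finite_setIl.
apply: contrapT => infs'; have := smin s' (conj Ls' infs').
by rewrite leNgt s's.
Qed.

(** If some points had [v]-weight below [b], the [u]-least one among them, with ties broken by [v],
    would be exceptional, whereas [b] is below the [v]-weight of every exceptional point. *)
Lemma weight_bounded_near : sublevel_finite u B ->
  exists b, exists2 e, 0 < e < 1 & forall v : 'rV[R]_n,
    (forall j, (1 - e) * u 0 j <= v 0 j <= (1 + e) * u 0 j) ->
    forall a, B a -> b <= wt v a.
Proof.
move=> u_fin; have [e /andP[e0 e1] eP] := initial_stable.
(* A lower bound for [wt v a] valid for all admissible [v] at once, since [0 <= v 0 j <= 2 * u 0 j]
   when [e < 1]. *)
pose h (a : 'rV[rat]_n) : R := - \sum_j `|ratr (a 0 j)| * (2 * u 0 j).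
have [b bP] : exists b, forall a, exceptional a -> b < h a.
  have [E0|/set0P En0] := eqVneq exceptional set0.
    by exists 0 => a; rewrite E0.
  have [a _ amin] := finite_argmin h exceptional_finite En0.
  by exists (h a - 1) => a' /amin; lra.
exists b, e; first by rewrite e0.
move=> v v_near a Ba; rewrite leNgt; apply/negP => ab.
pose V := B `&` [set x | wt v x < b].
have [||x lx] := @lexmin_neq0 R n u (v :: coords R n) V.
- by apply: sublevel_finite_sub u_fin => y [].
- by exists a.
have [Bx /= xb] := lexmin_sub lx.
have Ex : exceptional x.
  apply: exceptionalI => // i.
  have [q lq] := lexmin_neq0 (v :: coords R n) (Q_fin i u_gt0) (Qn0 i).
  have Q0q : Q0 i q := lexmin_argmin lq.
  exists q => // q' y Qq' By eqy.
  have [yb|yb] := ltP (wt v y) b.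
    have Vy : V y by split.
    by have [] := @lexmin_add _ _ [:: u; v] _ _ _ _ _ _ lq lx Qq' Vy eqy.
  (* Here [y] outweighs [x] for [v], so [q'] would have to be lighter than [q]; but [q] is [v]-least
     in [Q i], by stability against non-initial exponents and by the tie-break among initial
     ones. *)
  have : wt v q <= wt v q'.
    have [Q0q'|Q0q'] := pselect (Q0 i q').
      by have [_] := @lexmin_argmin _ _ v (coords R n) (Q0 i) _ lq; apply.
    by apply/ltW/(eP i v v_near).
  have : wt v q' + wt v y = wt v q + wt v x by rewrite -!wtD eqy.
  by move=> *; exfalso; lra.
have := bP _ Ex; apply/negP; rewrite -leNgt; apply: le_trans (ltW xb).
rewrite /h lerNl wtE -sumrN ler_sum// => j _.
have /andP[vj1 vj2] := v_near j; have uj := u_gt0 j.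
have vj0 : 0 <= v 0 j by apply: le_trans vj1; rewrite mulr_ge0 ?subr_ge0 ?ltW.
apply: le_trans (ler_norm _) _; rewrite normrN normrM (ger0_norm vj0).
rewrite ler_wpM2l//; apply: le_trans vj2 _.
by rewrite ler_pM2r//; lra.
Qed.

End Levels.

Lemma cone_gen_stable (R : realType) (n m : nat) (g : 'I_m -> 'rV[R]_n)
    (w : 'rV[R]_n) :
  (forall j, g j != 0 -> 0 < dot (g j) w) ->
  exists2 e, 0 < e & forall x : 'rV[R]_n, (forall i, `|x 0 i| < e) ->
    forall j, g j != 0 -> 0 < dot (g j) (w + x).
Proof.
move=> gw.
suff [e e0 eP] : exists2 e, 0 < e & forall j t, 0 < t -> t <= e ->
    forall x : 'rV[R]_n, (forall i, `|x 0 i| < t) -> g j != 0 ->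
    0 < dot (g j) (w + x).
  by exists e => // x xe j; apply: (eP j e).
apply: common_eps => j; have [gj|gj] := eqVneq (g j) 0; first by exists 1.
pose M := \sum_i `|g j 0 i| + 1.
have M0 : 0 < M by rewrite ltr_wpDl// sumr_ge0.
exists (dot (g j) w / M); first by rewrite divr_gt0 ?gw.
move=> t t0; rewrite ler_pdivlMr// => tM x xt _; rewrite dotDr.
have : - dot (g j) x <= t * \sum_i `|g j 0 i|.
  rewrite /dot -sumrN mulr_sumr ler_sum// => i _.
  apply: le_trans (ler_norm _) _; rewrite normrN normrM mulrC ler_wpM2r//.
  exact: ltW.
by move: tM; rewrite /M mulrDr mulr1; lra.
Qed.

(** * From weights of the support back to [tau] and to faces *)

Section SupportLevels.
Variables (R : realType) (n : nat) (K : fieldType) (xi : formal_series n K).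

Lemma tau_wtP (v : 'rV[R]_n) : tau R xi v <->
  (forall i, 0 <= v 0 i) /\ exists b, forall a, supp xi a -> b <= wt v a.
Proof.
split=> [[v0 [b bP]]|[v0 [b bP]]]; split=> //.
  exists b => a xia; rewrite leNgt; apply/negP => /ltW ab.
  suff : set0 (map_mx ratr a : 'rV[R]_n) by [].
  by rewrite -bP; split=> //; exists a.
(* The half-space in [tau] is closed, so a lower bound that may be attained is lowered by 1. *)
exists (b - 1); apply/seteqP; split=> // _ [[a xia <-] /= ab].
by have := bP _ xia; move: ab; rewrite -/(wt v a); lra.
Qed.

(** [p] cancels the finitely many terms of weight below [s], so its exponents are among those of
    [xi]. The convex hull of what remains lies in the half-space of weight at least [s], and the
    points of weight [s] lie on the face. *)
Lemma infinite_level_face (k : nat) (u : 'rV[R]_n) (s : R) :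
  laurent_puiseux k xi ->
  finite_set (supp xi `&` [set v | wt u v < s]) ->
  infinite_set (supp xi `&` [set v | wt u v = s]) ->
  exists2 p : formal_series n K, laurent_puiseux_polynomial k p &
    infinite_set (face (convex_hull (real_supp R (xi + p))) u
                  `&` real_supp R xi).
Proof.
move=> xik fin_lt inf_eq.
pose p : formal_series n K := fun a => if wt u a < s then - xi a else 0.
have p_supp a : supp p a -> supp xi a /\ wt u a < s.
  rewrite /supp/= /p; case: ifP => [as_|_]; last by rewrite eqxx.
  by rewrite oppr_eq0.
have xip a : (xi + p) a = if wt u a < s then 0 else xi a.
  rewrite (_ : (xi + p) a = xi a + p a)// /p; case: ifP => _.
    by rewrite subrr.
  by rewrite addr0.
exists p.
  split; first by move=> a /p_supp[/xik].
  by apply: sub_finite_set fin_lt => a /p_supp[].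
move=> fin_face; apply: inf_eq.
have inj : {in supp xi `&` [set v | wt u v = s] &,
            injective (map_mx ratr : 'rV[rat]_n -> 'rV[R]_n)}.
  by move=> a b _ _; apply: map_mx_inj; apply: fmorph_inj.
rewrite -(eq_finite_set (inj_card_eq inj)).
apply: sub_finite_set fin_face => _ [a [xia as_] <-].
split; last by exists a.
split.
  apply: sub_gen_smallest; exists a => //.
  by rewrite /supp/= xip as_ ltxx.
rewrite -/(wt u a) as_; pose half := [set v : 'rV[R]_n | s <= dot v u].
suff hull_half : convex_hull (real_supp R (xi + p)) `<=` half.
  by move=> v /hull_half.
apply: smallest_sub.
  move=> x y l; rewrite !inE /half/= => sx sy.
  rewrite dotDl !dotZl.
  have l0 : 0 <= l%:num by [].
  have l1 : l%:num <= 1 by [].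
  rewrite /unstable.onem; nra.
move=> _ [b xib <-]; rewrite /half/= -/(wt u b) leNgt.
by move: xib; rewrite /supp/= xip; case: ifP; rewrite ?eqxx.
Qed.

End SupportLevels.

Theorem theorem1p6 (R : realType) (K : fieldType) (charK : [pchar K] =i pred0)
    (n : nat) (xi : formal_series n K) (k : nat) (k_gt0 : (0 < k)%N)
    (xi_puiseux : laurent_puiseux k xi)
    (S : set 'rV[R]_n) (S_cone : polyhedral_cone S)
    (S_sconvex : strongly_convex S) (S_orthant : nonneg_orthant R n `<=` S)
    (s : 'rV[R]_n) (xi_supp : real_supp R xi `<=` [set s + v | v in S])
    (xi_alg : algebraic_series xi)
    (u : 'rV[R]_n) (u_gt0 : forall i, 0 < u 0 i)
    (u_boundary : boundary (tau R xi) u) :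
  exists2 p : formal_series n K, laurent_puiseux_polynomial k p &
    infinite_set (face (convex_hull (real_supp R (xi + p))) u
                  `&` real_supp R xi).
Proof.
have [m [g SE]] := S_cone; rewrite {}SE in S_sconvex S_orthant xi_supp.
have [w gw] := strongly_convex_dual_interior S_sconvex.
have cone_fin v : (forall j, g j != 0 -> 0 < dot (g j) v) ->
    sublevel_finite v (supp xi).
  move=> gv; apply: (cone_sublevel_finite k_gt0 gv (s := s)) => // a xia.
  have [|_ [c c0 ->] <-] := xi_supp (map_mx ratr a); first by exists a.
  by exists c.
have w_gt0 i : 0 < w 0 i.
  have delta0 : (delta_mx 0 i : 'rV[R]_n) != 0.
    by apply/eqP => /rowP/(_ i); rewrite !mxE !eqxx => /eqP; rewrite oner_eq0.
  have [|c c0 ec] := S_orthant (delta_mx 0 i).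
    by move=> j; rewrite mxE ler0n.
  rewrite -(dot_delta i w) ec; apply: (cone_dot_gt0 gw) => //.
  by rewrite -ec.
have power_sfin f : power_series f -> sfin w (f : formal_series n K).
  by move=> fpow; apply: sublevel_finite_sub (nat_sublevel_finite w_gt0).
have /choice[p pP] :=
  algebraic_recurrence charK power_sfin (cone_fin _ gw) xi_alg.
have Qnat i q : p i q != 0 -> forall j, q 0 j \is a Num.nat.
  by case: (pP i) => + _ _; apply.
have Qn0 i : [set q | p i q != 0] !=set0 by case: (pP i) => _ + _.
have Broot i q v : p i q != 0 -> xi v != 0 ->
    (forall q' v', p i q' != 0 -> xi v' != 0 -> q' + v' = q + v -> q' = q) ->
    root (p i q) (ratr (v 0 i)).
  by case: (pP i) => _ _; apply.
have [u_closure u_notint] := u_boundary.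
(* A point [u'] of [tau] close to [u] has weights bounded below on the support, and
   [t *: w + (u - u')] is still positive on the nonzero generators; a bound on the weight for
   [u + t *: w] thus bounds the weight for the latter. *)
have near_fin t : 0 < t -> sublevel_finite (u + t *: w) (supp xi).
  move=> t0; have [|e e0 eP] := @cone_gen_stable R n m g (t *: w).
    by move=> j gj; rewrite dotZr mulr_gt0 ?gw.
  have [u' [/tau_wtP[_ [b bP]] [_ uu']]] := u_closure _ (nbhsx_ballx u e e0).
  have -> : u + t *: w = u' + (t *: w + (u - u')).
    by rewrite addrCA [u' + _]addrC subrK addrC.
  move=> C; apply: sub_finite_set (cone_fin (t *: w + (u - u')) _ (C - b)).
    move=> a [xia /=]; rewrite wt_addw => aC; split=> //=.
    by have := bP _ xia; lra.
  by apply: eP => i; rewrite !mxE; apply: uu'.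
have [b bP] := weight_bounded_below charK u_gt0 w_gt0 Qnat Qn0 Broot near_fin.
have [u_fin|u_inf] := pselect (sublevel_finite u (supp xi)); last first.
  have [r [fin_lt inf_eq]] := exists_infinite_level charK u_gt0
    (cone_fin _ gw) Qnat Qn0 Broot bP u_inf.
  exact: infinite_level_face xi_puiseux fin_lt inf_eq.
case: u_notint.
have [b' [e /andP[e0 e1] eP]] :=
  weight_bounded_near charK u_gt0 Qnat Qn0 Broot u_fin.
(* A ball whose radius is at most every [e * u 0 j] stays within relative distance [e] of [u]. *)
have [r r0 rP] : exists2 r, 0 < r & forall j t, 0 < t -> t <= r ->
    t <= e * u 0 j.
  by apply: common_eps => j; exists (e * u 0 j) => //; rewrite mulr_gt0.
apply/nbhs_ballP; exists r => // v [_ uv].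
have v_near j : (1 - e) * u 0 j <= v 0 j <= (1 + e) * u 0 j.
  have := uv 0 j; rewrite /ball/= ltr_distl => /andP[h1 h2].
  by have := rP j r r0 (lexx r); rewrite mulrBl mulrDl !mul1r; lra.
apply/tau_wtP; split; last by exists b' => a xia; apply: eP.
move=> j; have /andP[+ _] := v_near j; apply: le_trans.
by rewrite mulr_ge0 ?subr_ge0 ?ltW.
Qed.
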